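(* Let $\Phi=\bigcup_{\alpha\in\mathring\Phi}\alpha\oplus\Lambda_\alpha$ be an irreducible reduced affine reflection system such that $\mathring\Phi$ is not of type $B_I$ (in particular not of type $B_2=C_2$), and not of type $A_1$. A subset $\Psi$ of $\Phi$ is a maximal root subsystem of $\Phi$ if and only if one of the following holds. (1) There is a $\mathbb Z$-linear function $p:\mathring\Phi\to Y$ with $p_\alpha\in Y_\alpha(\Psi)$ for all $\alpha\in\mathring\Phi$ such that one of the following holds: (1.i) $\Lambda_\ell\neq m\Lambda_s$ and $\Psi=\{\alpha\oplus\Lambda_s:\alpha\in\mathring\Phi_s\}\cup\{\alpha\oplus(p_\alpha+S):\alpha\in\mathring\Phi_\ell\}$, with $p_\alpha+S\subseteq\Lambda_\ell$ for all $\alpha\in\mathring\Phi_\ell$, where: if $\mathring\Phi$ is not of type $C_I$, $S$ is a maximal subgroup of $\Lambda_\ell$ containing $m\Lambda_s$; if $\mathring\Phi$ is of type $C_I$, $S$ is a union of cosets of $m\Lambda_s$ in $\Lambda_s$ containing $m\Lambda_s$ which is maximal among all such unions satisfying $p_\alpha+S\subsetneq\Lambda_\ell$ for all $\alpha\in\mathring\Phi_\ell$; (1.ii) $\langle\Lambda_\ell\rangle\neq\Lambda_s$ and $\Psi=\{\alpha\oplus(p_\alpha+H):\alpha\in\mathring\Phi_s\}\cup\{\alpha\oplus\Lambda_\ell:\alpha\in\mathring\Phi_\ell\}$, where $H$ is a maximal subgroup of $\Lambda_s$ that contains $\Lambda_\ell$; (1.iii) $\Psi=\{\alpha\oplus(p_\alpha+H):\alpha\in\mathring\Phi_s\}\cup\{\alpha\oplus((p_\alpha+H)\cap\Lambda_\ell):\alpha\in\mathring\Phi_\ell\}$,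 where $H$ is a maximal subgroup of $\Lambda_s$ satisfying $m\Lambda_s+H=\Lambda_s$. (2) $\mathrm{Gr}(\Psi)$ is a maximal root subsystem of $\mathring\Phi$, $Y_\alpha(\Psi)=\Lambda_\alpha$ for all $\alpha\in\mathrm{Gr}(\Psi)$, and one of the following holds: (2.a) $\mathrm{Gr}(\Psi)\neq\mathring\Phi_s$ and $\mathrm{Gr}(\Psi)\ne\mathring\Phi_\ell$; (2.b) $\mathrm{Gr}(\Psi)=\mathring\Phi_s$ and $\Lambda_\ell=m\Lambda_s$; (2.c) $\mathrm{Gr}(\Psi)=\mathring\Phi_\ell$ and $\langle\Lambda_\ell\rangle=\Lambda_s$.
   Context: Let $\mathring\Phi$ be a finite crystallographic root system in a Euclidean space $V$ (with $0\notin\mathring\Phi$), $(\beta,\alpha^\vee)=2(\beta,\alpha)/(\alpha,\alpha)$, $s_\alpha(\beta)=\beta-(\beta,\alpha^\vee)\alpha$, and let $Y$ be a finite-dimensional real vector space. An extension datum of type $(\mathring\Phi,Y)$, with $\mathring\Phi$ reduced, is a family of subsets $\Lambda_\alpha\subseteq Y$, $\alpha\in\mathring\Phi\cup\{0\}$, such that: $\Lambda_\beta-(\beta,\alpha^\vee)\Lambda_\alpha\subseteq\Lambda_{s_\alpha(\beta)}$ for all $\alpha,\beta\in\mathring\Phi$; $0\in\Lambda_\alpha$ for all $\alpha$; and $Y$ is the real span of $\bigcup_\alpha\Lambda_\alpha$. Here $A+B$, $kA=\{ka:a\in A\}$ are elementwise operations and $\langle A\rangle$ is the subgroup generated by $A$.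 The associated reduced affine reflection system is identified (ignoring imaginary roots) with its set of real roots $\Phi=\bigcup_{\alpha\in\mathring\Phi}\alpha\oplus\Lambda_\alpha\subseteq X=V\oplus Y$, where $\alpha\oplus A=\{\alpha\oplus a:a\in A\}$, with the form $(v_1\oplus y_1,v_2\oplus y_2)=(v_1,v_2)$ and reflections $s_\gamma(x)=x-\frac{2(x,\gamma)}{(\gamma,\gamma)}\gamma$ for $\gamma\in\Phi$. Every reduced affine reflection system (with finite underlying root system) is of this form up to isomorphism. It is irreducible iff $\mathring\Phi$ is. A set written $\{\alpha\oplus A_\alpha:\alpha\in T\}$ means $\bigcup_{\alpha\in T}\alpha\oplus A_\alpha$. For irreducible reduced $\mathring\Phi$, $\mathring\Phi_s$ and $\mathring\Phi_\ell$ are the sets of short and long roots, $m$ is the lacing number ($1$, $2$ or $3$), and $\Lambda_\alpha$ depends only on the length of $\alpha$; it is denoted $\Lambda_s$ or $\Lambda_\ell$. In the simply laced case $\mathring\Phi_s=\mathring\Phi_\ell=\mathring\Phi$, $\Lambda_s=\Lambda_\ell$, $m=1$. When $\mathring\Phi$ is not of type $B_I$ or $A_1$, $\Lambda_s$ is a subgroup of $Y$. A root subsystem of $\Phi$ (or of $\mathring\Phi$) is a non-empty subset $\Psi$ with $s_\alpha(\beta)\in\Psi$ for all $\alpha,\beta\in\Psi$; it is maximal if it is proper and not strictly contained in another proper root subsystem. For $\Psi\subseteq\Phi$, $\mathrm{Gr}(\Psi)=\{\alpha\in\mathring\Phi:\exists y\in\Lambda_\alpha,\ \alpha\oplus y\in\Psi\}$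 and $Y_\alpha(\Psi)=\{y\in\Lambda_\alpha:\alpha\oplus y\in\Psi\}$. A $\mathbb Z$-linear function $p:\mathring\Phi\to Y$, $\alpha\mapsto p_\alpha$, is the restriction to $\mathring\Phi$ of a group homomorphism from the root lattice $\mathbb Z\mathring\Phi$ to $Y$. A maximal subgroup is a maximal proper subgroup. *)

(* Defs.v *)
From HB Require Import structures.
From mathcomp Require Export all_boot all_order all_algebra.
From mathcomp Require Export sesquilinear.
From mathcomp Require Export boolp classical_sets functions cardinality reals.

Set Implicit Arguments.
Unset Strict Implicit.
Unset Printing Implicit Defensive.

Import Order.TTheory GRing.Theory Num.Theory.

Local Open Scope classical_set_scope.
Local Open Scope ring_scope.

Section Sets.
Context {R : realType}.

Definition sumset (W : zmodType) (A B : set W) : set W :=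
  [set a + b | a in A & b in B].

Definition dilate (W : lmodType R) (k : R) (A : set W) : set W :=
  [set k *: a | a in A].

Definition translate (W : zmodType) (x : W) (A : set W) : set W :=
  [set x + a | a in A].

Definition subgroup (W : zmodType) (A : set W) : Prop :=
  A 0 /\ forall x y, A x -> A y -> A (x - y).

Definition generated (W : zmodType) (A : set W) : set W :=
  smallest (@subgroup W) A.

Definition maximal_subgroup (W : zmodType) (G H : set W) : Prop :=
  [/\ subgroup H, H `<` G &
      forall K : set W, subgroup K -> H `<=` K -> K `<` G -> K = H].

Definition spans (W : vectType R) (A : set W) : Prop :=
  forall U : {vspace W}, (forall x, A x -> x \in U) -> U = fullv.

(* S is a union of translates x + M with x in L. *)
Definition coset_union (W : zmodType) (M L S : set W) : Prop :=
  exists2 T : set W, T `<=` L & S = \bigcup_(x in T) translate x M.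

End Sets.

Section Reflections.
Context {R : realType} {W : lmodType R}.
Variable f : W -> W -> R.

(* (b, a^\vee) *)
Definition pairing (b a : W) : R := 2 * f b a / f a a.

(* s_a(b) *)
Definition refl (a b : W) : W := b - pairing b a *: a.

Definition root_subsystem (Phi Psi : set W) : Prop :=
  [/\ Psi !=set0, Psi `<=` Phi &
      forall a b, Psi a -> Psi b -> Psi (refl a b)].

Definition maximal_root_subsystem (Phi Psi : set W) : Prop :=
  [/\ root_subsystem Phi Psi, Psi `<` Phi &
      forall Psi' : set W, root_subsystem Phi Psi' -> Psi' `<` Phi ->
        ~ (Psi `<` Psi')].

End Reflections.

Section FiniteRootSystems.
Context {R : realType} {V : vectType R}.
Variable f : V -> V -> R.

Record root_system (Phi0 : set V) : Prop := RootSystem {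
  root_finite : finite_set Phi0;
  root_neq0 : ~ Phi0 0;
  root_span : spans Phi0;
  root_refl : forall a b, Phi0 a -> Phi0 b -> Phi0 (refl f a b);
  root_int : forall a b, Phi0 a -> Phi0 b -> pairing f b a \is a Num.int
}.

Definition reduced (Phi0 : set V) : Prop :=
  forall (a : V) (c : R), Phi0 a -> Phi0 (c *: a) -> c = 1 \/ c = -1.

Definition irreducible (Phi0 : set V) : Prop :=
  Phi0 !=set0 /\
  forall A B : set V, Phi0 = A `|` B ->
    (forall a b, A a -> B b -> f a b = 0) -> A = set0 \/ B = set0.

(* If all roots have the same length, every root is both short and long. *)
Definition short_roots (Phi0 : set V) : set V :=
  [set a | Phi0 a /\ forall b, Phi0 b -> f a a <= f b b].

Definition long_roots (Phi0 : set V) : set V :=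
  [set a | Phi0 a /\ forall b, Phi0 b -> f b b <= f a a].

(* The lacing number is the squared length ratio of a long to a short root. *)
Definition lacing_number (Phi0 : set V) (m : nat) : Prop :=
  exists a b, [/\ short_roots Phi0 a, long_roots Phi0 b & f b b = m%:R * f a a].

End FiniteRootSystems.

(* The last condition is automatic when both sets are root systems. *)
Definition root_iso (R : realType) (V V' : vectType R)
    (f : V -> V -> R) (f' : V' -> V' -> R)
    (Phi0 : set V) (Phi0' : set V') : Prop :=
  exists g : {linear V -> V'},
    [/\ bijective g, g @` Phi0 = Phi0' &
        forall a b, Phi0 a -> Phi0 b ->
          pairing f' (g b) (g a) = pairing f b a].

Section Types.
Context {R : realType}.

Definition std_dot (n : nat) (u v : 'rV[R]_n) : R := (u *m v^T) 0 0.

(* { +-e_i +- e_j : i != j } *)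
Definition roots_D (n : nat) : set 'rV[R]_n :=
  [set x | exists (i j : 'I_n) (s t : bool),
     i != j /\ x = (-1) ^+ s *: 'e_i + (-1) ^+ t *: 'e_j].

Definition roots_B (n : nat) : set 'rV[R]_n :=
  [set x | exists (i : 'I_n) (s : bool), x = (-1) ^+ s *: 'e_i] `|` @roots_D n.

Definition roots_C (n : nat) : set 'rV[R]_n :=
  [set x | exists (i : 'I_n) (s : bool), x = (-1) ^+ s *: (2 *: 'e_i)]
  `|` @roots_D n.

Definition type_A1 (V : vectType R) (Phi0 : set V) : Prop :=
  exists2 a : V, a != 0 & Phi0 = [set a; - a].

(* B_1 is A_1, so the rank is taken to be at least 2. *)
Definition type_B (V : vectType R) (f : V -> V -> R) (Phi0 : set V) : Prop :=
  exists2 n : nat, (2 <= n)%N & root_iso f (@std_dot n) Phi0 (@roots_B n).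

(* Contains C_2 = B_2. *)
Definition type_C (V : vectType R) (f : V -> V -> R) (Phi0 : set V) : Prop :=
  exists2 n : nat, (2 <= n)%N & root_iso f (@std_dot n) Phi0 (@roots_C n).

End Types.

Section AffineReflectionSystems.
Context {R : realType} {V Y : vectType R}.
Variable f : V -> V -> R.

(* Only the values of Lam on Phi0 and at 0 are meaningful. *)
Record extension_datum (Phi0 : set V) (Lam : V -> set Y) : Prop :=
  ExtensionDatum {
  ext_refl : forall a b, Phi0 a -> Phi0 b ->
    sumset (Lam b) (dilate (- pairing f b a) (Lam a)) `<=` Lam (refl f a b);
  ext_0 : forall a, (Phi0 `|` [set 0]) a -> Lam a 0;
  ext_span : spans (\bigcup_(a in Phi0 `|` [set 0]) Lam a)
}.

(* The union over a in T of a (+) A_a, in X = V (+) Y = V * Y. *)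
Definition roots_over (T : set V) (A : V -> set Y) : set (V * Y) :=
  \bigcup_(a in T) [set (a, y) | y in A a].

Definition affine_roots (Phi0 : set V) (Lam : V -> set Y) : set (V * Y) :=
  roots_over Phi0 Lam.

Definition affine_form (x y : (V * Y)%type) : R := f x.1 y.1.

(* For irreducible Phi0, Lam is constant on short roots and on long roots, so
   the unions below are its common values there. *)
Definition Lam_s (Phi0 : set V) (Lam : V -> set Y) : set Y :=
  \bigcup_(a in short_roots f Phi0) Lam a.

Definition Lam_l (Phi0 : set V) (Lam : V -> set Y) : set Y :=
  \bigcup_(a in long_roots f Phi0) Lam a.

Definition Gr (Phi0 : set V) (Lam : V -> set Y) (Psi : set (V * Y)) : set V :=
  [set a | Phi0 a /\ exists2 y, Lam a y & Psi (a, y)].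

Definition Y_ (Lam : V -> set Y) (Psi : set (V * Y)) (a : V) : set Y :=
  [set y | Lam a y /\ Psi (a, y)].

(* p restricted to Phi0 extends to a homomorphism from the root lattice to Y;
   the values of p outside Phi0 and of h outside the lattice are irrelevant. *)
Definition Zlinear (Phi0 : set V) (p : V -> Y) : Prop :=
  exists2 h : V -> Y,
    (forall x y, generated Phi0 x -> generated Phi0 y -> h (x + y) = h x + h y)
    & forall a, Phi0 a -> h a = p a.

End AffineReflectionSystems.

Section CaseC.
Context {R : realType} {V Y : vectType R}.

Definition admissible_coset_union (T : set V) (p : V -> Y) (M Ls Ll S : set Y) :
    Prop :=
  [/\ coset_union M Ls S, M `<=` S &
      forall a, T a -> translate (p a) S `<` Ll].

Definition maximal_coset_union (T : set V) (p : V -> Y) (M Ls Ll S : set Y) :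
    Prop :=
  admissible_coset_union T p M Ls Ll S /\
  forall S' : set Y, admissible_coset_union T p M Ls Ll S' -> S `<=` S' -> S' = S.

End CaseC.

(* Main.v *)
From HB Require Import structures.
Require Import Defs.
From mathcomp Require Import ring lra zify.
Set Implicit Arguments.
Unset Strict Implicit.
Unset Printing Implicit Defensive.
Import Order.TTheory GRing.Theory Num.Theory.
Local Open Scope classical_set_scope.
Local Open Scope ring_scope.

(**
   A real root of the affine system is a pair (a, y), and the reflection in
   (a, x) sends (b, y) to (s_a b, y - <b, a^> x), where <b, a^> is the pairing
   of b with the coroot of a. So a root subsystem Psi consists of its gradient
   Gr(Psi), a root subsystem of the finite system, and of fibres Z_a over it
   with Z_b - <b, a^> Z_a inside Z_(s_a b).

   If the gradient is proper, a maximal Psi is the full preimage of its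
   gradient, and the gradient is itself maximal. Such a preimage fails to be
   maximal only if a larger proper subsystem has all finite roots as gradient.

   If the gradient is everything, simple roots give a Z-linear p with
   (a, p_a) in Psi for all a: choose p freely on the simple roots, and the
   reflections in the (b, p_b) with b simple carry the choice to all roots
   ([linear_section]). The translated fibres Z_a - p_a contain 0 and satisfy
   the same inclusion, and so they depend only on the length of a. Let H and S
   be the fibres over short and long roots, and m the lacing number. In an
   irreducible system that is neither A_1 nor of type B two short roots span an
   A_2, and this makes H a subgroup; a short and a long root together give
   S <= H and S + m H <= S; and S is a subgroup as soon as two long roots span
   an A_2, which fails only in type C ([subsystem_data]). Every subsystem that contains Psi has the same
   section p, so that maximality of Psi becomes maximality of the pair (H, S)
   among the proper ones.

   If H is all of Lambda_s, only S can grow, and this is the first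
   alternative. Otherwise Psi lies in the set of all roots (a, y) with y in
   p_a + H. This set is a proper subsystem, hence equal to Psi, and H is a
   maximal subgroup. Then m Lambda_s + H is either Lambda_s, which is the third
   alternative, or H. In the latter situation the whole short part can be
   adjoined to Psi without changing its long part; the result has to be the
   full system, so that the long part of Psi was full and H contains Lambda_l,
   which is the second alternative.

   The converse directions compare (H, S) with the pair of a larger proper
   subsystem. The point used throughout is that the reflection in a root
   (c, x) of Psi preserves both Psi and the full system; if the gradient is
   everything, a fibre that is full over one root is therefore full over all
   roots of the same length ([full_orbit]). *)

(** * The Euclidean form and pairs of roots *)

Section Form.
Context {R : realType} {V : vectType R}.
Context (f : {dot V for idfun}).

Lemma formC x y : f x y = f y x.
Proof. by rewrite [LHS](hermC f) /= expr0 mul1r. Qed.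
Lemma formDl x y z : f (x + y) z = f x z + f y z.
Proof. exact: linearDl. Qed.
Lemma formBl x y z : f (x - y) z = f x z - f y z.
Proof. exact: linearBl. Qed.
Lemma formNl x y : f (- x) y = - f x y.
Proof. exact: linearNl. Qed.
Lemma formZl k x y : f (k *: x) y = k * f x y.
Proof. exact: linearZl_LR. Qed.
Lemma formDr x y z : f z (x + y) = f z x + f z y.
Proof. exact: linearDr. Qed.
Lemma formBr x y z : f z (x - y) = f z x - f z y.
Proof. exact: linearBr. Qed.
Lemma formNr x y : f x (- y) = - f x y.
Proof. exact: linearNr. Qed.
Lemma formZr k x y : f x (k *: y) = k * f x y.
Proof. exact: linearZr_LR. Qed.
Lemma form_gt0 x : x != 0 -> 0 < f x x.
Proof. exact: neq0_dnorm_gt0. Qed.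
Lemma form_eq0 x : f x x = 0 -> x = 0.
Proof.
by move=> fx0; apply: contra_eq (lexx (0 : R)) => /form_gt0; rewrite fx0 ltxx.
Qed.

Lemma pairingDl x y a : pairing f (x + y) a = pairing f x a + pairing f y a.
Proof. by rewrite /pairing formDl; ring. Qed.
Lemma pairingNl x a : pairing f (- x) a = - pairing f x a.
Proof. by rewrite /pairing formNl; ring. Qed.
Lemma pairingBl x y a : pairing f (x - y) a = pairing f x a - pairing f y a.
Proof. by rewrite pairingDl pairingNl. Qed.
Lemma pairingZl k x a : pairing f (k *: x) a = k * pairing f x a.
Proof. by rewrite /pairing formZl; ring. Qed.
Lemma pairingNr x a : pairing f x (- a) = - pairing f x a.
Proof. by rewrite /pairing formNl !formNr opprK mulrN mulNr. Qed.
Lemma pairingE b a : a != 0 -> pairing f b a * f a a = 2 * f b a.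
Proof. by move=> /form_gt0 /lt0r_neq0 a0; rewrite /pairing mulfVK. Qed.
Lemma pairing_self a : a != 0 -> pairing f a a = 2.
Proof. by move=> /form_gt0 /lt0r_neq0 a0; rewrite /pairing mulfK. Qed.
Lemma pairing_eq0 b a : a != 0 -> (pairing f b a == 0) = (f b a == 0).
Proof.
move=> /form_gt0 /lt0r_neq0 a0.
by rewrite /pairing mulf_eq0 invr_eq0 (negPf a0) orbF mulf_eq0 pnatr_eq0.
Qed.

Lemma refl_self a : a != 0 -> refl f a a = - a.
Proof. by move=> a0; rewrite /refl pairing_self // scaler_nat mulr2n opprD addNKr. Qed.
Lemma refl_orth a b : f b a = 0 -> refl f a b = b.
Proof. by rewrite /refl /pairing => ->; rewrite mulr0 mul0r scale0r subr0. Qed.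
Lemma pairing_refl a b : a != 0 -> pairing f (refl f a b) a = - pairing f b a.
Proof. by move=> a0; rewrite /refl pairingBl pairingZl pairing_self //; ring. Qed.
Lemma reflK a : a != 0 -> involutive (refl f a).
Proof.
by move=> a0 b; rewrite {1}/refl pairing_refl // /refl scaleNr opprK addrNK.
Qed.
Lemma refl_form a b c : a != 0 -> f (refl f a b) (refl f a c) = f b c.
Proof.
move=> a0; rewrite /refl !(formBl, formBr, formZl, formZr).
have Eb := pairingE b a0; have Ec := pairingE c a0.
by rewrite (formC a c); nra.
Qed.
Lemma refl_form_self a b : a != 0 -> f (refl f a b) a = - f b a.
Proof.
by move=> a0; rewrite /refl formBl formZl pairingE //; ring.
Qed.
End Form.

Section RootSystem.
Context {R : realType} {V : vectType R} {f : {dot V for idfun}} {Phi0 : set V}.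
Context (rs : root_system f Phi0) (hred : reduced Phi0).

Lemma root_nz a : Phi0 a -> a != 0.
Proof. by move=> Pa; apply/eqP => a0; apply: (root_neq0 rs); rewrite -a0. Qed.

Lemma root_gt0 a : Phi0 a -> 0 < f a a.
Proof. by move=> /root_nz; exact: form_gt0. Qed.

Lemma rootN a : Phi0 a -> Phi0 (- a).
Proof. by move=> Pa; rewrite -(refl_self f (root_nz Pa)); exact: root_refl. Qed.

Lemma root_intP a b : Phi0 a -> Phi0 b -> exists z : int, pairing f b a = z%:~R.
Proof. by move=> Pa Pb; have /intrP := root_int rs Pa Pb. Qed.

(** Positivity of the form at a - c b, with c chosen to make it orthogonal to
    b. In a reduced system two roots are proportional only if they are equal or
    opposite. *)
Lemma cauchy_schwarz_lt a b : Phi0 a -> Phi0 b -> b != a -> b != - a ->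
  f a b ^+ 2 < f a a * f b b.
Proof.
move=> Pa Pb ba bNa.
have fb := root_gt0 Pb.
pose c := f a b / f b b.
have : a - c *: b != 0.
  apply/eqP => /subr0_eq ac.
  have : c = 1 \/ c = -1 by apply: hred Pb _; rewrite -ac.
  case=> c1; rewrite c1 ?scale1r ?scaleN1r in ac.
    by rewrite ac eqxx in ba.
  by rewrite ac opprK eqxx in bNa.
move=> /(form_gt0 f); rewrite !(formBl, formBr, formZl, formZr) (formC f b a).
have Ec : c * f b b = f a b by rewrite /c mulfVK ?lt0r_neq0.
rewrite Ec subrr subr0 => h.
have : 0 < (f a a - c * f a b) * f b b by rewrite mulr_gt0.
by rewrite mulrBl mulrAC Ec subr_gt0 expr2.
Qed.

(** The pairing is a nonzero integer whose square is below 4 by the strict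
    Cauchy-Schwarz inequality. *)
Lemma pairing_pm1 a b : Phi0 a -> Phi0 b -> f a a <= f b b -> f a b != 0 ->
  b != a -> b != - a -> pairing f a b = 1 \/ pairing f a b = -1.
Proof.
move=> Pa Pb le n0 ba bNa.
have lt := cauchy_schwarz_lt Pa Pb ba bNa.
have [z Ez] := root_intP Pb Pa.
have fb := root_gt0 Pb.
have E := pairingE f a (root_nz Pb).
have z0 : z != 0.
  apply: contra n0 => /eqP z0; rewrite -(pairing_eq0 f _ (root_nz Pb)) Ez z0.
  by rewrite mulr0z.
have z4 : z%:~R ^+ 2 < 4 :> R.
  rewrite -Ez -(ltr_pM2r fb) -(ltr_pM2r fb).
  have -> : pairing f a b ^+ 2 * f b b * f b b = 4 * f a b ^+ 2.
    by rewrite -mulrA -expr2 -exprMn E; ring.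
  have : f a a * f b b <= f b b * f b b by rewrite ler_pM2r.
  lra.
have {}z4 : z ^+ 2 < 4 by move: z4; rewrite -[4]/(4%:~R) -rmorphXn /= ltr_int.
rewrite Ez; have [->|->] : z = 1 \/ z = -1 by nia.
  by left.
by right.
Qed.

(** Unless b is a or -a, the product of the two pairings is an integer between
    1 and 3, and the pairing with the longer root is 1 or -1. *)
Lemma length_ratio a b : Phi0 a -> Phi0 b -> f a a <= f b b -> f a b != 0 ->
  exists k : nat, [/\ (0 < k < 4)%N & f b b = k%:R * f a a].
Proof.
move=> Pa Pb le n0.
have [->|ba] := eqVneq b a; first by exists 1%N; rewrite mul1r.
have [->|bNa] := eqVneq b (- a).
  by exists 1%N; rewrite mul1r formNl formNr opprK.
have lt := cauchy_schwarz_lt Pa Pb ba bNa.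
have [w Ew] := root_intP Pa Pb.
have fb := root_gt0 Pb; have fa := root_gt0 Pa.
have E := pairingE f a (root_nz Pb).
have E' := pairingE f b (root_nz Pa).
rewrite (formC f b a) -E Ew in E'.
have [z1 [z1E Ez]] : exists z1 : int, (z1 = 1 \/ z1 = -1) /\ pairing f a b = z1%:~R.
  have [e|e] := pairing_pm1 Pa Pb le n0 ba bNa; rewrite e.
    by exists 1; split => //; left.
  by exists (-1); split => //; right.
rewrite Ez in E' E.
have Eb : f b b = (z1 * w)%:~R * f a a.
  case: z1E E' => ->; rewrite rmorphM /= ?rmorph1 ?rmorphN1; lra.
have q : (0 < (z1 * w)%:~R :> R) by rewrite -(pmulr_lgt0 _ fa) -Eb.
have q4 : (z1 * w)%:~R < 4 :> R.
  rewrite -(ltr_pM2r fa) -Eb -(ltr_pM2r fb).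
  suff : f b b * f b b = 4 * f a b ^+ 2 by nra.
  have -> : 4 * f a b ^+ 2 = (2 * f a b) ^+ 2 by ring.
  by rewrite -E; case: z1E => ->; rewrite ?mulr1z ?mulrN1z; ring.
move: q q4; rewrite ltr0z -[4]/(4%:~R) ltr_int => q q4.
exists `|(z1 * w)%R|%N; split; first by lia.
by rewrite Eb natr_absz gtr0_norm.
Qed.
End RootSystem.

(** * Weyl orbits *)

Section Orbits.
Context {R : realType} {V : vectType R} (f : {dot V for idfun}) (Phi0 : set V).

Inductive weyl_orbit (a : V) : set V :=
| weyl_orbit_id : weyl_orbit a a
| weyl_orbit_refl b c : Phi0 b -> weyl_orbit a c -> weyl_orbit a (refl f b c).

Lemma weyl_orbit_trans a b c :
  weyl_orbit a b -> weyl_orbit b c -> weyl_orbit a c.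
Proof. by move=> ab; elim=> // {}c d Pc _; exact: weyl_orbit_refl. Qed.

Context (rs : root_system f Phi0) (hred : reduced Phi0) (hirr : irreducible f Phi0).

Lemma weyl_orbit_root a b : Phi0 a -> weyl_orbit a b -> Phi0 b.
Proof. by move=> Pa; elim=> // c d Pc _; exact: (root_refl rs). Qed.

Lemma weyl_orbit_form a b : weyl_orbit a b -> f b b = f a a.
Proof. by elim=> // c d Pc _ <-; rewrite refl_form // (root_nz rs). Qed.

(** Having a common non-orthogonal root with a is stable under reflections: if
    c is such a root for a and d, then for a and s_b d one takes c if b is
    orthogonal to d, the reflection of c in b if b is orthogonal to a only, and
    b itself otherwise. *)
Lemma common_neighbour_orbit a b : Phi0 a -> weyl_orbit a b ->
  exists c, [/\ Phi0 c, f c a != 0 & f c b != 0].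
Proof.
move=> Pa; elim=> [|b' d Pb ad [c [Pc ca cd]]].
  by exists a; split=> //; rewrite lt0r_neq0 // (root_gt0 rs).
have b0 := root_nz rs Pb.
have [bd|bd] := eqVneq (f d b') 0; first by exists c; rewrite refl_orth.
have [ba|ba] := eqVneq (f b' a) 0.
  exists (refl f b' c); split.
  - exact: (root_refl rs).
  - rewrite -[a in f _ a](@refl_orth _ _ f b' a); first by rewrite refl_form.
    by rewrite formC.
  - by rewrite refl_form.
by exists b'; split=> //; rewrite formC refl_form_self // oppr_eq0.
Qed.

(** The roots orthogonal to the orbit of a are orthogonal to all other roots,
    so irreducibility leaves none. *)
Lemma orbit_meets a b : Phi0 a -> Phi0 b -> exists2 c, weyl_orbit a c & f c b != 0.
Proof.
move=> Pa.
pose M := [set b | Phi0 b /\ exists2 c, weyl_orbit a c & f c b != 0].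
have orth b1 b2 : M b1 -> (Phi0 `\` M) b2 -> f b1 b2 = 0.
  move=> [Pb1 [c ac cb1]] [Pb2 nM].
  have zero c' : weyl_orbit a c' -> f c' b2 = 0.
    by move=> ac'; apply: contra_notP nM => /eqP n0; split=> //; exists c'.
  have := zero _ (weyl_orbit_refl Pb1 ac).
  rewrite /refl formBl formZl (zero c) // sub0r => /eqP.
  rewrite oppr_eq0 mulf_eq0 pairing_eq0 ?(root_nz rs Pb1) //.
  by rewrite (negPf cb1) => /eqP.
have MS : M `<=` Phi0 by move=> x [].
have [||M0 Pb] := hirr.2 M (Phi0 `\` M) _ orth; last first.
- have [//|nM] := pselect (M b); last first.
    have : (Phi0 `\` M) b by [].
    by rewrite M0.
  by move=> [].
- move=> M0; have : M a.
    split=> //; exists a; first exact: weyl_orbit_id.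
    by rewrite lt0r_neq0 // (root_gt0 rs).
  by rewrite M0.
- by rewrite setDUK.
Qed.

Lemma same_length_pairing a b : Phi0 a -> Phi0 b -> f a a = f b b ->
  f a b != 0 -> b != a -> b != - a ->
  exists2 e, e ^+ 2 = 1 & pairing f a b = e /\ pairing f b a = e.
Proof.
move=> Pa Pb ab n0 ba bNa.
have E : pairing f b a = pairing f a b by rewrite /pairing ab formC.
have le : f a a <= f b b by rewrite ab.
have [e|e] := pairing_pm1 rs hred Pa Pb le n0 ba bNa.
  by exists 1; rewrite ?E // expr1n.
by exists (-1); rewrite ?E // sqrrN expr1n.
Qed.

(** Some conjugate c of a is not orthogonal to b. If c is neither b nor -b, the
    two span an A_2, in which reflections carry c to b. *)
Lemma same_length_orbit a b : Phi0 a -> Phi0 b -> f a a = f b b ->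
  weyl_orbit a b.
Proof.
move=> Pa Pb ab; have [c ac cb] := orbit_meets Pa Pb.
apply: (weyl_orbit_trans ac).
have Pc := weyl_orbit_root Pa ac.
have {a Pa ab ac} cbE : f c c = f b b by rewrite (weyl_orbit_form ac).
have b0 := root_nz rs Pb; have c0 := root_nz rs Pc.
have [->|bc] := eqVneq b c; first exact: weyl_orbit_id.
have [->|bNc] := eqVneq b (- c).
  by rewrite -(refl_self f c0); apply: weyl_orbit_refl => //; exact: weyl_orbit_id.
have [e e2 [Ec Eb]] := same_length_pairing Pc Pb cbE cb bc bNc.
pose d := refl f c (refl f b c).
have dE : d = - e *: b.
  rewrite /d [in refl f b c]/refl Ec /refl pairingBl pairingZl pairing_self // Eb.
  rewrite -expr2 e2 [2 - 1](_ : _ = 1) ?scale1r ?scaleNr; last by ring.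
  by rewrite addrAC subrr sub0r.
have od : weyl_orbit c d.
  by do 2!apply: weyl_orbit_refl => //; exact: weyl_orbit_id.
have : e = 1 \/ e = -1.
  by have /eqP := e2; rewrite sqrf_eq1 => /orP[]/eqP; [left|right].
case=> eE; rewrite eE ?scaleN1r ?opprK ?scale1r in dE; last by rewrite -dE.
have -> : b = refl f b d by rewrite dE -(refl_self f b0) reflK.
exact: weyl_orbit_refl.
Qed.

Lemma common_neighbour a b : Phi0 a -> Phi0 b -> f a a = f b b ->
  exists c, [/\ Phi0 c, f c a != 0 & f c b != 0].
Proof.
by move=> Pa Pb ab; apply: common_neighbour_orbit => //; exact: same_length_orbit.
Qed.
End Orbits.

(** * Simple roots and linear sections *)

Lemma finite_set_ind (R : realType) (T : choiceType) (A : set T) (g : T -> R)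
    (P : T -> Prop) : finite_set A ->
  (forall a, A a -> (forall b, A b -> g b < g a -> P b) -> P a) ->
  forall a, A a -> P a.
Proof.
move=> /finite_seqP[s ->] step a.
have [n] := ubnP (size [seq b <- s | g b < g a]).
elim: n a => // n IHn a sn sa; apply: step => // b sb ba; apply: IHn => //.
rewrite ltnS in sn; apply: leq_trans sn.
have -> : [seq c <- s | g c < g b] =
          [seq c <- [seq c <- s | g c < g a] | g c < g b].
  rewrite -filter_predI; apply: eq_filter => c /=.
  by case: (ltP (g c) (g b)) => // /lt_trans ->.
rewrite size_filter ltn_neqAle count_size andbT -all_count.
by apply/allPn; exists b; rewrite ?mem_filter ?ba ?ltxx.
Qed.

Section SimpleRoots.
Context {R : realType} {V : vectType R} (f : {dot V for idfun}) (Phi0 : set V).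
Context (rs : root_system f Phi0) (hred : reduced Phi0).

Lemma form_suml I (r : seq I) (P : pred I) (F : I -> V) y :
  f (\sum_(i <- r | P i) F i) y = \sum_(i <- r | P i) f (F i) y.
Proof. exact: linear_sumlz. Qed.

Lemma form_sumr I (r : seq I) (P : pred I) (F : I -> V) y :
  f y (\sum_(i <- r | P i) F i) = \sum_(i <- r | P i) f y (F i).
Proof. exact: linear_sumr. Qed.

(** Built by adding the roots one at a time: if v is orthogonal to the new
    root a, then v + t a is not, and a large t avoids the finitely many values
    that make it orthogonal to one of the previous roots. *)
Lemma regular_vector : exists v, forall a, Phi0 a -> f v a != 0.
Proof.
have [s E] := (finite_seqP _).1 (root_finite rs).
have : forall a, a \in s -> a != 0.
  by move=> a sa; apply: (root_nz rs); rewrite E.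
rewrite {}E; elim: s => [|a s IHs] nz; first by exists 0.
have [|v vP] := IHs; first by move=> b sb; apply: nz; rewrite inE sb orbT.
have fa : 0 < f a a by apply: form_gt0; apply: nz; rewrite inE eqxx.
have [va|va] := eqVneq (f v a) 0; last first.
  by exists v => b; rewrite /= inE => /orP[/eqP -> //|]; exact: vP.
pose t := 1 + \sum_(b <- s) `|f v b / f a b|.
have t1 : 1 <= t by rewrite lerDl sumr_ge0.
exists (v + t *: a) => b; rewrite /= inE formDl formZl => /orP[/eqP ->|sb].
  by rewrite va add0r; nra.
apply/eqP => E; have vb := vP b sb.
have ab : f a b != 0.
  by apply: contraNneq vb => ab; rewrite -E ab mulr0 addr0.
have tE : t = - (f v b / f a b).
  by apply: (mulIf ab); rewrite mulNr mulfVK //; lra.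
(* a bad t would be bounded by one of the summands of t - 1 *)
have : `|t| <= t - 1.
  rewrite {1}tE normrN /t addrC addKr (big_rem b) //= lerDl.
  by rewrite sumr_ge0.
rewrite ger0_norm; lra.
Qed.

Lemma root_sub a b : Phi0 a -> Phi0 b -> 0 < f a b -> a != b -> Phi0 (a - b).
Proof.
move=> Pa Pb ab nab.
have naNb : a != - b.
  apply: contraTneq ab => ->; rewrite formNl oppr_gt0 -leNgt.
  by rewrite ltW ?(root_gt0 rs).
wlog le : a b Pa Pb ab nab naNb / f a a <= f b b => [th|].
  have [|/ltW] := leP (f a a) (f b b); first exact: th.
  move=> ba; rewrite -opprB; apply: (rootN rs); apply: th => //.
  - by rewrite formC.
  - by rewrite eq_sym.
  - by rewrite eq_sym eqr_oppLR.
have pab : 0 < pairing f a b by rewrite divr_gt0 ?mulr_gt0 ?(root_gt0 rs).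
have [||||] := pairing_pm1 rs hred Pa Pb le.
- by rewrite gt_eqF.
- by rewrite eq_sym.
- by rewrite eq_sym eqr_oppLR.
- by move=> e; have := root_refl rs Pb Pa; rewrite /refl e scale1r.
- by move=> e; rewrite e ltr0N1 in pab.
Qed.

Context (v : V) (vreg : forall a, Phi0 a -> f v a != 0).

Definition positive a := Phi0 a /\ 0 < f v a.

Definition simple_root a :=
  positive a /\ forall b c, positive b -> positive c -> a <> b + c.

(** The nonzero combinations of simple roots with natural coefficients,
    presented without coordinates. *)
Inductive simple_cone : set V :=
| simple_cone_root a : simple_root a -> simple_cone a
| simple_cone_add x y : simple_cone x -> simple_cone y -> simple_cone (x + y).

Lemma positive_or_opp a : Phi0 a -> positive a \/ positive (- a).
Proof.
move=> Pa; have := vreg Pa; rewrite neq_lt => /orP[?|?]; [right|by left].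
by split; rewrite ?formNr ?oppr_gt0 //; exact: (rootN rs).
Qed.

Lemma positive_cone a : positive a -> simple_cone a.
Proof.
move=> [Pa]; move: a Pa.
apply: (finite_set_ind (g := f v) (root_finite rs)) => a Pa IHa va.
have [sa|nsa] := pselect (simple_root a); first exact: simple_cone_root.
have [b [c [[Pb vb] [Pc vc] E]]] :
    exists b c, [/\ positive b, positive c & a = b + c].
  apply: contrapT => n; apply: nsa; split=> // b c pb pc E.
  by apply: n; exists b, c.
by rewrite E; apply: simple_cone_add; apply: IHa => //; rewrite E formDr; lra.
Qed.

(** Otherwise a - b would be a root, and a or b would be the sum of two positive
    roots. *)
Lemma simple_obtuse a b : simple_root a -> simple_root b -> a != b ->
  f a b <= 0.
Proof.
move=> [pa sa] [pb sb] ab; rewrite leNgt; apply/negP => fab.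
have Pab := root_sub pa.1 pb.1 fab ab.
have [p|p] := positive_or_opp Pab.
  by apply: (sa b (a - b)) => //; rewrite addrC subrK.
by apply: (sb a (- (a - b))) => //; rewrite opprB addrC subrK.
Qed.

(** The coefficient t of b is isolated. Only two properties of the remainder
    are kept: it is a combination of simple roots other than b, hence makes an
    obtuse angle with b, and it is detected by v. *)
Lemma cone_split b x : simple_root b -> simple_cone x ->
  exists t x', [/\ 0 <= t, x = t *: b + x', f x' b <= 0 & x' = 0 \/ 0 < f v x'].
Proof.
move=> sb; elim=> [a sa|{}x y _ [t [x' [t0 -> bx vx]]] _ [u [y' [u0 -> yb vy]]]].
  have [->|ab] := eqVneq a b.
    by exists 1, 0; rewrite scale1r addr0 linear0l; split=> //; left.
  by exists 0, a; rewrite scale0r add0r simple_obtuse //; split=> //; right; case: sa.1.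
exists (t + u), (x' + y'); split.
- exact: addr_ge0.
- by rewrite scalerDl addrACA.
- by rewrite formDl; lra.
case: vx => [->|vx]; first by rewrite add0r.
right; case: vy => [->|vy]; first by rewrite addr0.
by rewrite formDr addr_gt0.
Qed.

(** If the image were negative, then a and minus the image would be two elements
    of the cone whose sum is a multiple of b. Pairing this sum with b and with v
    forces their components outside b to vanish, so that a would be a multiple
    of b. *)
Lemma simple_refl_positive a b : simple_root b -> positive a -> a != b ->
  positive (refl f b a).
Proof.
move=> sb pa ab; have [Pb vb] := sb.1; have [Pa va] := pa.
have Pc := root_refl rs Pb Pa.
have [//|pc] := positive_or_opp Pc.
have [t [a' [t0 aE ba' va']]] := cone_split sb (positive_cone pa).
have [u [c' [u0 cE bc' vc']]] := cone_split sb (positive_cone pc).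
pose r := pairing f a b - t - u.
have rE : r *: b = a' + c'.
  apply: (addrI (t *: b + u *: b)); rewrite [RHS]addrACA -aE -cE.
  by rewrite /refl opprB addrC subrK -!scalerDl /r; congr (_ *: _); ring.
have fb := root_gt0 rs Pb.
have r0 : r <= 0.
  rewrite -(pmulr_lle0 _ fb) -formZl rE formDl; lra.
have vr : r * f v b = f v a' + f v c' by rewrite -formZr rE formDr.
have a'0 : a' = 0.
  case: va' => // va'; have vc0 : 0 <= f v c'.
    by case: vc' => [->|/ltW//]; rewrite linear0r.
  have := mulr_le0_ge0 r0 (ltW vb); rewrite vr leNgt ltr_wpDr //.
rewrite a'0 addr0 in aE.
have [t1|t1] : t = 1 \/ t = -1 by apply: hred Pb _; rewrite -aE.
  by rewrite aE t1 scale1r eqxx in ab.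
lra.
Qed.

(** A positive root that is not simple has a positive product with some simple
    b, because it lies in the cone and has a positive square. The reflection in
    b then lowers its height f v. *)
Lemma positive_ind (P : V -> Prop) :
  (forall a, simple_root a -> P a) ->
  (forall a b, simple_root b -> Phi0 a -> P a -> P (refl f b a)) ->
  forall a, positive a -> P a.
Proof.
move=> P1 P2 a [Pa]; move: a Pa.
apply: (finite_set_ind (g := f v) (root_finite rs)) => a Pa IHa va.
have [sa|nsa] := pselect (simple_root a); first exact: P1.
have pa : positive a by [].
have [b sb ab] : exists2 b, simple_root b & 0 < f a b.
  apply: contrapT => n.
  have : forall x, simple_cone x -> f a x <= 0.
    move=> x; elim=> [b sb|{}x y _ ax _ ay].
      by rewrite leNgt; apply/negP => ab; apply: n; exists b.
    by rewrite formDr; lra.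
  move=> /(_ _ (positive_cone pa)); have := root_gt0 rs Pa; lra.
have [Pb vb] := sb.1.
have nab : a != b by apply/eqP => E; apply: nsa; rewrite E.
have [Pc vc] := simple_refl_positive sb pa nab.
rewrite -(reflK f (root_nz rs Pb) a); apply: P2 => //; apply: IHa => //.
rewrite /refl formBr formZr ltrBlDr ltrDl mulr_gt0 //.
by rewrite divr_gt0 ?mulr_gt0 ?(root_gt0 rs).
Qed.

(** Given a relation with coefficients k, let y be the combination with
    coefficients |k|. By obtuseness the square of y is at most the square of the
    relation, so y = 0; and f v is positive on the simple roots. *)
Lemma simple_free (X : seq V) : uniq X ->
  (forall a, a \in X -> simple_root a) -> free X.
Proof.
move=> uX sX; suff: free (in_tuple X) by [].
apply/freeP => k k0 i.
have sXi (j : 'I_(size X)) : simple_root X`_j by apply: sX; rewrite mem_nth.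
pose y := \sum_(j < size X) `|k j| *: X`_j.
have y0 : y = 0.
  apply: (@form_eq0 _ _ f); apply: le_anti.
  rewrite andbC; apply/andP; split.
    by have [->|/(form_gt0 f)/ltW//] := eqVneq y 0; rewrite linear0l.
  have -> : 0 = f (\sum_(j < size X) k j *: X`_j) (\sum_(j < size X) k j *: X`_j).
    by rewrite k0 linear0l.
  rewrite /y !form_suml; apply: ler_sum => j _.
  rewrite !form_sumr; apply: ler_sum => l _.
  rewrite !formZl !formZr !mulrA.
  have [->|jl] := eqVneq j l.
    by rewrite -normrM ger0_norm // -expr2 sqr_ge0.
  have fjl : f X`_j X`_l <= 0.
    by apply: simple_obtuse => //; rewrite nth_uniq.
  by rewrite -normrM ler_wnM2r // ler_norm.
have : f v y = 0 by rewrite y0 linear0r.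
rewrite form_sumr => /psumr_eq0P H.
have : f v (`|k i| *: X`_i) = 0.
  apply: H => // j _; rewrite formZr mulr_ge0 //.
  by apply: ltW; case: (sXi j).1.
have vX : f v X`_i != 0 by rewrite gt_eqF //; case: (sXi i).1.
by move/eqP; rewrite formZr mulf_eq0 normr_eq0 (negPf vX) orbF => /eqP.
Qed.
End SimpleRoots.

Section LinearSections.
Context {R : realType} {V Y : vectType R} {f : {dot V for idfun}} {Phi0 : set V}.
Context (rs : root_system f Phi0) (hred : reduced Phi0).

(** Choose points of Z over the simple roots and extend linearly, which is
    possible by freeness. Each reflection in a simple root keeps the graph of
    the extension inside Z, and the simple roots reach all positive ones. *)
Lemma linear_section (Z : V -> set Y) :
  (forall a, Phi0 a -> Z a !=set0) ->
  (forall a b x y, Phi0 a -> Phi0 b -> Z a x -> Z b y ->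
     Z (refl f a b) (y - pairing f b a *: x)) ->
  exists p : {linear V -> Y}, forall a, Phi0 a -> Z a (p a).
Proof.
move=> Zn0 Zrefl.
have [v vreg] := regular_vector rs.
have [s sE] := (finite_seqP _).1 (root_finite rs).
pose X := [seq a <- undup s | `[< simple_root f Phi0 v a >]].
have uX : uniq X by rewrite filter_uniq // undup_uniq.
have XP a : a \in X <-> simple_root f Phi0 v a.
  rewrite mem_filter mem_undup; split=> [/andP[/asboolP]//|sa].
  by apply/andP; split; [exact/asboolP|have := sa.1.1; rewrite sE].
have fX := simple_free rs hred vreg uX (fun a => (XP a).1).
have [y yP] : exists y : V -> Y, forall a, Phi0 a -> Z a (y a).
  have : forall a, exists y, Phi0 a -> Z a y.
    move=> a; have [Pa|nPa] := pselect (Phi0 a); last by exists 0.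
    by have [y Zy] := Zn0 a Pa; exists y.
  by move=> /choice[y yP]; exists y.
pose p a := \sum_(i < size X) coord (in_tuple X) i a *: y X`_i.
have plin : linear p.
  move=> k a b; rewrite /p scaler_sumr -big_split /=; apply: eq_bigr => i _.
  by rewrite linearP scalerDl scalerA.
pose pL := HB.pack_for {linear V -> Y} p (GRing.isLinear.Build _ _ _ _ p plin).
exists pL.
have pX a : simple_root f Phi0 v a -> pL a = y a.
  move=> /XP aX; rewrite /= /p.
  have iX : (index a X < size X)%N by rewrite index_mem.
  pose k := Ordinal iX.
  have aE : a = (in_tuple X)`_k by rewrite /= nth_index.
  rewrite (bigD1 k) //= big1 => [|j jk].
    by rewrite {1}aE coord_free // eqxx scale1r addr0 nth_index.
  by rewrite aE coord_free // eq_sym (negPf jk) scale0r.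
have pos a : positive f Phi0 v a -> Z a (pL a).
  move: a; apply: (positive_ind rs hred vreg) => [a sa|a b sb Pa Za].
    by rewrite pX //; apply: yP; exact: sa.1.1.
  have -> : pL (refl f b a) = pL a - pairing f a b *: pL b.
    by rewrite /refl linearB linearZ.
  apply: Zrefl => //; first exact: sb.1.1.
  by rewrite pX //; apply: yP; exact: sb.1.1.
move=> a Pa; have [/pos//|/pos ZNa] := positive_or_opp rs vreg Pa.
have PNa := rootN rs Pa.
have nz := root_nz rs PNa.
have := Zrefl _ _ _ _ PNa PNa ZNa ZNa.
rewrite refl_self // opprK pairing_self // linearN scalerN opprK.
by rewrite scaler_nat mulr2n addKr.
Qed.
End LinearSections.

(** * Root lengths *)

Definition a2_pair (R : realType) (V : vectType R) (f : V -> V -> R)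
    (T : set V) : Prop :=
  exists a b, [/\ T a, T b, pairing f a b = -1 & pairing f b a = -1].

Section Lengths.
Context {R : realType} {V : vectType R} {f : {dot V for idfun}} {Phi0 : set V}.
Context (rs : root_system f Phi0) (hred : reduced Phi0) (hirr : irreducible f Phi0).
Local Notation short := (short_roots f Phi0).
Local Notation long := (long_roots f Phi0).

Lemma short_root a : short a -> Phi0 a. Proof. by case. Qed.
Lemma long_root a : long a -> Phi0 a. Proof. by case. Qed.

Lemma short_form a b : short a -> short b -> f a a = f b b.
Proof. by move=> [Pa sa] [Pb sb]; apply: le_anti; rewrite sa // sb. Qed.

Lemma long_form a b : long a -> long b -> f a a = f b b.
Proof. by move=> [Pa la] [Pb lb]; apply: le_anti; rewrite la // lb. Qed.

Lemma short_of_form a b : short a -> Phi0 b -> f b b = f a a -> short b.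
Proof. by move=> [_ sa] Pb E; split=> // c Pc; rewrite E sa. Qed.

Lemma long_of_form a b : long a -> Phi0 b -> f b b = f a a -> long b.
Proof. by move=> [_ la] Pb E; split=> // c Pc; rewrite E la. Qed.

Lemma short_refl a b : Phi0 a -> short b -> short (refl f a b).
Proof.
move=> Pa sb; apply: (short_of_form sb).
  exact: (root_refl rs Pa (short_root sb)).
by rewrite refl_form ?(root_nz rs).
Qed.

Lemma long_refl a b : Phi0 a -> long b -> long (refl f a b).
Proof.
move=> Pa lb; apply: (long_of_form lb).
  exact: (root_refl rs Pa (long_root lb)).
by rewrite refl_form ?(root_nz rs).
Qed.

Lemma shortN a : short a -> short (- a).
Proof.
move=> sa; apply: (short_of_form sa); first exact: (rootN rs (short_root sa)).
by rewrite formNl formNr opprK.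
Qed.

Lemma longN a : long a -> long (- a).
Proof.
move=> la; apply: (long_of_form la); first exact: (rootN rs (long_root la)).
by rewrite formNl formNr opprK.
Qed.

Lemma no_a2_pair (T : set V) : T `<=` Phi0 -> (forall a, T a -> T (- a)) ->
  (forall a b, T a -> T b -> f a a = f b b) -> ~ a2_pair f T ->
  forall a b, T a -> T b -> f a b != 0 -> b = a \/ b = - a.
Proof.
move=> TP TN Tf no a b Ta Tb ab.
have [->|ba] := eqVneq b a; first by left.
have [->|bNa] := eqVneq b (- a); first by right.
have [e /eqP e2 [ea eb]] := same_length_pairing rs hred (TP _ Ta) (TP _ Tb)
  (Tf _ _ Ta Tb) ab ba bNa.
exfalso; apply: no; move: e2; rewrite sqrf_eq1 => /orP[]/eqP e1; rewrite e1 in ea eb.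
  by exists (- a), b; rewrite pairingNl pairingNr ea eb; split=> //; exact: TN.
by exists a, b.
Qed.

Context (m : nat) (hm : lacing_number f Phi0 m).

Lemma lacing_form a b : short a -> long b -> f b b = m%:R * f a a.
Proof.
have [a' [b' [sa' lb' E]]] := hm => sa lb.
by rewrite (short_form sa sa') (long_form lb lb').
Qed.

(** A conjugate of the longer root is not orthogonal to the shorter one. *)
Lemma length_ratio_le a b : Phi0 a -> Phi0 b -> f a a <= f b b ->
  exists k : nat, (0 < k < 4)%N /\ f b b = k%:R * f a a.
Proof.
move=> Pa Pb ab; have [c bc ca] := orbit_meets rs hirr Pb Pa.
have Pc := weyl_orbit_root rs Pb bc.
have cE := weyl_orbit_form rs bc.
have [||k [k4 E]] := length_ratio rs hred Pa Pc.
- by rewrite cE.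
- by rewrite formC.
by exists k; rewrite -cE.
Qed.

Lemma lacing_bounds : (0 < m < 4)%N.
Proof.
have [a [b [sa lb E]]] := hm.
have [k [k4 E']] := length_ratio_le (short_root sa) (long_root lb) (sa.2 _ lb.1).
have fa := lt0r_neq0 (root_gt0 rs sa.1).
by move: E; rewrite E' => /(mulIf fa)/eqP; rewrite eqr_nat => /eqP <-.
Qed.

(** The ratios of c to a short root and of a long root to c multiply to m. As m
    is at most 3, one of the two is 1. *)
Lemma short_or_long c : Phi0 c -> short c \/ long c.
Proof.
move=> Pc; have [a [b [sa lb E]]] := hm.
have [k [k4 Ek]] := length_ratio_le sa.1 Pc (sa.2 _ Pc).
have [l [l4 El]] := length_ratio_le Pc lb.1 (lb.2 _ Pc).
have fa := lt0r_neq0 (root_gt0 rs sa.1).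
have : m = (l * k)%N.
  apply/eqP; rewrite -(eqr_nat R); apply/eqP; apply: (mulIf fa).
  by rewrite -E El Ek natrM mulrA.
have mb := lacing_bounds => mE.
have [k1|l1] : k = 1%N \/ l = 1%N by nia.
  by left; apply: (short_of_form sa) => //; rewrite Ek k1 mul1r.
by right; apply: (long_of_form lb) => //; rewrite El l1 mul1r.
Qed.

Lemma simply_laced a : m = 1%N -> Phi0 a -> short a /\ long a.
Proof.
move=> m1 Pa; have [a' [b' [sa lb E]]] := hm; rewrite m1 mul1r in E.
have aa : f a a = f a' a'.
  by apply: le_anti; rewrite -{1}E lb.2 // sa.2.
split; first exact: (short_of_form sa).
by apply: (long_of_form lb) => //; rewrite E.
Qed.

Lemma short_not_long a : (1 < m)%N -> short a -> ~ long a.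
Proof.
move=> m2 sa la; have := lacing_form sa la.
rewrite -{1}[f a a]mul1r => /(mulIf (lt0r_neq0 (root_gt0 rs sa.1)))/eqP.
by rewrite eq_sym pnatr_eq1; lia.
Qed.

Lemma long_short_pairing a b : short a -> long b ->
  pairing f b a = m%:R * pairing f a b.
Proof.
move=> sa lb; have fa := lt0r_neq0 (root_gt0 rs sa.1).
have fb := root_gt0 rs lb.1; rewrite (lacing_form sa lb) in fb.
rewrite /pairing (lacing_form sa lb) (formC f b a); field.
rewrite fa /=; apply: contraTneq fb => ->; by rewrite mul0r ltxx.
Qed.

Lemma short_long_pm1 a b : (1 < m)%N -> short a -> long b -> f a b != 0 ->
  pairing f a b = 1 \/ pairing f a b = -1.
Proof.
move=> m2 sa lb ab.
have nlong := short_not_long m2 sa.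
apply: (pairing_pm1 rs hred sa.1 lb.1 _ ab); first exact: lb.2 sa.1.
  by apply: contra_notN nlong => /eqP <-.
by apply: contra_notN nlong => /eqP E; rewrite -[a]opprK -E; exact: longN.
Qed.

Lemma short_long_pair : (1 < m)%N ->
  exists a b, [/\ short a, long b & pairing f a b = -1].
Proof.
move=> m2; have [a [b [sa lb _]]] := hm.
have [c ac cb] := orbit_meets rs hirr sa.1 lb.1.
have sc : short c.
  apply: (short_of_form sa); first exact: (weyl_orbit_root rs sa.1 ac).
  exact: (weyl_orbit_form rs ac).
have [e|e] := short_long_pm1 m2 sc lb cb; last by exists c, b.
by exists (- c), b; rewrite pairingNl e; split=> //; exact: shortN.
Qed.
End Lengths.

(** * Families of sets compatible with the reflections *)

Lemma subgroupD (W : zmodType) (H : set W) x y :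
  subgroup H -> H x -> H y -> H (x + y).
Proof.
move=> [H0 HB] Hx Hy; rewrite -[y]opprK -[- y]sub0r.
by apply: (HB _ _ Hx); exact: HB.
Qed.

Lemma subgroupN (W : zmodType) (H : set W) x : subgroup H -> H x -> H (- x).
Proof. by move=> [H0 HB] Hx; rewrite -sub0r; exact: HB. Qed.

Lemma subgroupB (W : zmodType) (H : set W) x y :
  subgroup H -> H x -> H y -> H (x - y).
Proof. by move=> [_ HB]; exact: HB. Qed.

Lemma subgroup_int (R : realType) (W : lmodType R) (H : set W) (z : R) x :
  subgroup H -> z \is a Num.int -> H x -> H (z *: x).
Proof.
move=> sH /intrP[k ->] Hx.
have HM n : H (x *+ n).
  by elim: n => [|n IH]; rewrite ?mulr0n ?mulrS; [case: sH|exact: subgroupD].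
rewrite scaler_int; case: k => n; first exact: HM.
by rewrite NegzE mulrNz; apply: subgroupN => //; exact: HM.
Qed.

Section Families.
Context {R : realType} {V Y : vectType R} (f : {dot V for idfun}) (Phi0 : set V).
Context (rs : root_system f Phi0) (hred : reduced Phi0) (hirr : irreducible f Phi0).
Local Notation short := (short_roots f Phi0).
Local Notation long := (long_roots f Phi0).

(** This is the condition on the fibres of a root subsystem with all roots as
    gradient, seen from a section. An extension datum satisfies it as well, and
    the lemmas below are applied to both. *)
Definition reflection_family (Z : V -> set Y) : Prop :=
  (forall a, Phi0 a -> Z a 0) /\
  forall a b x y, Phi0 a -> Phi0 b -> Z a x -> Z b y ->
    Z (refl f a b) (y - pairing f b a *: x).

Context (Z : V -> set Y) (hZ : reflection_family Z).

Lemma family_orbit a b : Phi0 a -> weyl_orbit f Phi0 a b -> Z a `<=` Z b.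
Proof.
move=> Pa; elim=> // c d Pc ad IH y Zy.
rewrite -[y]subr0 -(scaler0 _ (pairing f d c)); apply: hZ.2 => //.
- exact: (weyl_orbit_root rs Pa ad).
- exact: hZ.1.
- exact: IH.
Qed.

Lemma family_length a b : Phi0 a -> Phi0 b -> f a a = f b b -> Z a = Z b.
Proof.
move=> Pa Pb ab; apply/seteqP; split; apply: family_orbit => //.
  exact: same_length_orbit.
by apply: same_length_orbit.
Qed.

Lemma family_sub2 a x y : Phi0 a -> Z a x -> Z a y -> Z a (y - 2 *: x).
Proof.
move=> Pa Zx Zy; have := hZ.2 _ _ _ _ Pa Pa Zx Zy.
have a0 := root_nz rs Pa; rewrite refl_self // pairing_self //.
rewrite (@family_length (- a) a) //; first exact: (rootN rs).
by rewrite formNl formNr opprK.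
Qed.

Lemma familyN a x : Phi0 a -> Z a x -> Z a (- x).
Proof.
move=> Pa Zx; have := family_sub2 Pa Zx Zx.
by rewrite scaler_nat mulr2n opprD addNKr.
Qed.

(** With a and b spanning an A_2, the reflection in b moves a to another root of
    the same length and adds an element of the fibre. *)
Lemma family_subgroup a b : Phi0 a -> Phi0 b -> f a a = f b b ->
  pairing f a b = -1 -> subgroup (Z a).
Proof.
move=> Pa Pb ab e; split=> [|x y Zx Zy]; first exact: hZ.1.
have Zy' : Z b (- y) by rewrite -(family_length Pa Pb ab); exact: familyN.
have := hZ.2 _ _ _ _ Pb Pa Zy' Zx.
rewrite e scaleNr opprK scale1r.
rewrite (@family_length (refl f b a) a) //; first exact: (root_refl rs).
by rewrite refl_form // (root_nz rs).
Qed.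

Lemma family_short_subgroup a : a2_pair f short -> short a -> subgroup (Z a).
Proof.
move=> [c [d [sc sd e _]]] sa.
rewrite (family_length sa.1 sc.1 (short_form sa sc)).
exact: family_subgroup sc.1 sd.1 (short_form sc sd) e.
Qed.

Lemma family_long_subgroup a : a2_pair f long -> long a -> subgroup (Z a).
Proof.
move=> [c [d [lc ld e _]]] la.
rewrite (family_length la.1 lc.1 (long_form la lc)).
exact: family_subgroup lc.1 ld.1 (long_form lc ld) e.
Qed.

Context (m : nat) (hm : lacing_number f Phi0 m) (hA2 : a2_pair f short).

(** Reflect a short root c in a long root d with pairing -1, starting from 0 in
    the fibre over c. If m = 1 the two fibres agree. *)
Lemma family_long_short a b : short a -> long b -> Z b `<=` Z a.
Proof.
move=> sa lb y Zy; have mb := lacing_bounds rs hred hirr hm.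
have [m1|m2] : m = 1%N \/ (1 < m)%N by lia.
  suff -> : Z a = Z b by [].
  by apply: family_length sa.1 lb.1 _; rewrite (lacing_form hm sa lb) m1 mul1r.
have [c [d [sc ld e]]] := short_long_pair rs hred hirr hm m2.
rewrite (family_length lb.1 ld.1 (long_form lb ld)) in Zy.
have := hZ.2 _ _ _ _ ld.1 sc.1 Zy (hZ.1 _ sc.1).
have sr := short_refl rs ld.1 sc.
by rewrite e scaleN1r opprK add0r (family_length sr.1 sa.1 (short_form sr sa)).
Qed.

(** Here the long root d is reflected in the short root c: the pairing is -m. *)
Lemma family_long_add a b x y : short a -> long b -> Z a x -> Z b y ->
  Z b (y + m%:R *: x).
Proof.
move=> sa lb Zx Zy; have mb := lacing_bounds rs hred hirr hm.
have [m1|m2] : m = 1%N \/ (1 < m)%N by lia.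
  have ab : f a a = f b b by rewrite (lacing_form hm sa lb) m1 mul1r.
  rewrite m1 scale1r -(family_length sa.1 lb.1 ab).
  apply: subgroupD => //; first exact: family_short_subgroup.
  by rewrite (family_length sa.1 lb.1 ab).
have [c [d [sc ld e]]] := short_long_pair rs hred hirr hm m2.
rewrite (family_length lb.1 ld.1 (long_form lb ld)) in Zy.
rewrite (family_length sa.1 sc.1 (short_form sa sc)) in Zx.
have := hZ.2 _ _ _ _ sc.1 ld.1 Zx Zy.
have lr := long_refl rs sc.1 ld.
rewrite (long_short_pairing rs hm sc ld) e mulrN1 scaleNr opprK.
by rewrite (family_length lr.1 lb.1 (long_form lr lb)).
Qed.
End Families.

(** * Orthogonal frames and the types A_1, B and C *)

Section Frame.
Context {R : realType} {V : vectType R} (f : {dot V for idfun}) (Phi0 : set V).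
Context (rs : root_system f Phi0) (hred : reduced Phi0) (hirr : irreducible f Phi0).

(** In type B the short roots, and in type C the long roots, are the vectors of
    an orthogonal basis and their opposites. *)
Definition frame (T : set V) (n : nat) (e : 'I_n -> V) : Prop :=
  [/\ forall i, T (e i),
      forall i j, i != j -> f (e i) (e j) = 0,
      forall t, T t -> exists i (s : bool), t = (-1) ^+ s *: e i &
      forall v, v = \sum_i (pairing f v (e i) / 2) *: e i].

(** The members of T on the positive side of a regular vector are pairwise
    orthogonal. They span, because every root b is proportional to the
    difference of some c in T and its reflection in b. *)
Lemma orthogonal_frame (T : set V) :
  T `<=` Phi0 -> T !=set0 ->
  (forall a t, Phi0 a -> T t -> T (refl f a t)) ->
  (forall a b, T a -> T b -> f a b != 0 -> b = a \/ b = - a) ->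
  exists n (e : 'I_n -> V), frame T e.
Proof.
move=> TP [t0 Tt0] Trefl Torth.
have [v vreg] := regular_vector rs.
have [s sE] := (finite_seqP _).1 (root_finite rs).
pose X := [seq a <- undup s | `[< T a >] && (0 < f v a)].
have uX : uniq X by rewrite filter_uniq // undup_uniq.
have XP a : a \in X <-> T a /\ 0 < f v a.
  rewrite mem_filter mem_undup; split=> [/andP[/andP[/asboolP]]//|[Ta va]].
  by rewrite va andbT; apply/andP; split; [exact/asboolP|have := TP _ Ta; rewrite sE].
pose e (i : 'I_(size X)) := X`_i.
have eX i : T (e i) /\ 0 < f v (e i) by apply/XP; exact: mem_nth.
have e0 i : e i != 0 by apply: (root_nz rs); apply: TP; case: (eX i).
have eorth i j : i != j -> f (e i) (e j) = 0.
  move=> ij; apply/eqP; apply: contraT => fij.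
  have [ji|ji] := Torth _ _ (eX i).1 (eX j).1 fij.
    by move/eqP: ji ij; rewrite nth_uniq // => /eqP/val_inj ->; rewrite eqxx.
  by have := (eX j).2; rewrite ji formNr oppr_gt0 => /ltW; rewrite leNgt (eX i).2.
have TX t : T t -> exists i (s : bool), t = (-1) ^+ s *: e i.
  have tX t' : T t' -> 0 < f v t' -> exists i, t' = e i.
    move=> Tt vt; have tX : t' \in X by apply/XP.
    have iX : (index t' X < size X)%N by rewrite index_mem.
    by exists (Ordinal iX); rewrite /e /= nth_index.
  move=> Tt; have := vreg _ (TP _ Tt); rewrite neq_lt => /orP[vt|vt]; last first.
    by have [i ->] := tX _ Tt vt; exists i, false; rewrite scale1r.
  have TNt : T (- t).
    by rewrite -(refl_self f (root_nz rs (TP _ Tt))); apply: Trefl => //; exact: TP.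
  have [|i ti] := tX _ TNt; first by rewrite formNr oppr_gt0.
  by exists i, true; rewrite expr1 scaleN1r -ti opprK.
exists (size X), e; split=> //; first by move=> i; case: (eX i).
have TU t : T t -> t \in <<X>>%VS.
  move=> /TX[i [b ->]]; apply: memvZ; apply: memv_span; exact: mem_nth.
have UV : <<X>>%VS = fullv.
  apply: (root_span rs) => b Pb.
  have [c tc cb] := orbit_meets rs hirr (TP _ Tt0) Pb.
  have Tc : T c by elim: tc {cb} => // b' d Pb' _ Td; exact: Trefl.
  have pcb : pairing f c b != 0 by rewrite pairing_eq0 // (root_nz rs).
  have -> : b = (pairing f c b)^-1 *: (c - refl f b c).
    by rewrite /refl opprB addrC subrK scalerA mulVf // scale1r.
  by rewrite memvZ // memvB // TU //; exact: Trefl.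
have coordE w j : pairing f w (e j) = 2 * coord (in_tuple X) j w.
  have wX : w \in <<in_tuple X>>%VS by rewrite UV memvf.
  rewrite {1}(coord_span wX) /pairing form_suml (bigD1 j) //= big1 => [|i ij].
    by rewrite formZl addr0 -/(e j) mulrA mulfK // lt0r_neq0 // form_gt0.
  by rewrite formZl -/(e i) eorth // mulr0.
move=> w; have wX : w \in <<in_tuple X>>%VS by rewrite UV memvf.
rewrite {1}(coord_span wX); apply: eq_bigr => i _.
by rewrite coordE mulrC mulKf // pnatr_eq0.
Qed.

Context (T : set V) (n : nat) (e : 'I_n -> V) (L : R).
Context (TP : T `<=` Phi0) (fr : frame T e) (eL : forall i, f (e i) (e i) = L).

Lemma frame_root i : Phi0 (e i). Proof. by case: fr => /(_ i)/TP. Qed.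

Lemma frame_pairing i j : pairing f (e i) (e j) = (i == j)%:R * 2.
Proof.
have [->|ij] := eqVneq i j.
  by rewrite mul1r pairing_self // (root_nz rs (frame_root j)).
by case: fr => _ orth _ _; rewrite /pairing orth // mulr0 !mul0r.
Qed.

Lemma frame_form x y :
  4 * f x y = L * \sum_i pairing f x (e i) * pairing f y (e i).
Proof.
have [_ _ _ ex] := fr; rewrite [in LHS](ex x) form_suml !mulr_sumr.
apply: eq_bigr => i _.
have := pairingE f y (root_nz rs (frame_root i)); rewrite eL formZl => E.
have -> : f (e i) y = pairing f y (e i) * L / 2 by rewrite E formC; field.
by field.
Qed.

Definition frame_support c := [set i | pairing f c (e i) != 0]%SET.

(** Comparing this value with the known squared length of a root determines how
    many coordinates of the root are nonzero. *)
Lemma frame_norm c k :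
  (forall i, pairing f c (e i) != 0 -> pairing f c (e i) ^+ 2 = k ^+ 2) ->
  4 * f c c = L * (#|frame_support c|%:R * k ^+ 2).
Proof.
move=> ck; rewrite frame_form; congr (_ * _).
rewrite (bigID (mem (frame_support c))) /= [X in _ + X]big1 => [|i]; last first.
  by rewrite inE negbK => /eqP ->; rewrite mul0r.
rewrite addr0 -mulr_natl mulr1 // mulr_natl -sumr_const.
by apply: eq_bigr => i; rewrite inE => /ck <-; rewrite expr2.
Qed.

Context (k : R) (k0 : k != 0).
Context (nT : forall c, Phi0 c -> ~ T c -> #|frame_support c| = 2%N /\
  forall i, pairing f c (e i) != 0 -> pairing f c (e i) ^+ 2 = k ^+ 2).

(** The roots of type B for k = 2, and of type C for k = 1. *)
Definition frame_roots : set 'rV[R]_n :=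
  [set x | exists (i : 'I_n) (s : bool), x = (-1) ^+ s *: ((2 / k) *: 'e_i)]
  `|` @roots_D R n.

Lemma sqr_sign (x : R) : x ^+ 2 = k ^+ 2 -> exists s : bool, x = (-1) ^+ s * k.
Proof.
move/eqP; rewrite eqf_sqr => /orP[]/eqP->.
  by exists false; rewrite mul1r.
by exists true; rewrite mulN1r.
Qed.

(** Coordinates in the frame, divided by k, are up to a common factor an
    isometry. A root outside T has exactly two nonzero coordinates, both k or
    -k. Conversely, for i and j distinct, a common non-orthogonal root of e_i
    and e_j has its nonzero coordinates there, and the reflections in e_i and
    e_j change its signs independently. *)
Lemma frame_iso : root_iso f (@std_dot R n) Phi0 frame_roots.
Proof.
pose g v : 'rV[R]_n := \row_i (pairing f v (e i) / k).
have glin : linear g.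
  move=> c x y; apply/rowP => i; rewrite !mxE pairingDl pairingZl; field; exact: k0.
pose gL := HB.pack_for {linear V -> 'rV[R]_n} g (GRing.isLinear.Build _ _ _ _ g glin).
have [eT _ Te ex] := fr.
have gE v i : gL v 0 i = pairing f v (e i) / k by rewrite /= mxE.
have ge i : gL (e i) = (2 / k) *: 'e_i.
  apply/rowP => j; rewrite gE frame_pairing !mxE eqxx /= eq_sym; ring.
have two c (i j : 'I_n) (s t : bool) : i != j -> frame_support c = [set i; j]%SET ->
    pairing f c (e i) = (-1) ^+ s * k -> pairing f c (e j) = (-1) ^+ t * k ->
    gL c = (-1) ^+ s *: 'e_i + (-1) ^+ t *: 'e_j.
  move=> ij sup ci cj; apply/rowP => l; rewrite gE !mxE eqxx /=.
  have [->|li] := eqVneq l i.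
    by rewrite ci (negPf ij) mulfK // mulr1 mulr0 addr0.
  have [->|lj] := eqVneq l j; first by rewrite cj mulfK // mulr0 mulr1 add0r.
  have : l \notin frame_support c by rewrite sup !inE (negPf li).
  by rewrite inE negbK => /eqP ->; rewrite mul0r !mulr0 addr0.
exists gL; split.
- exists (fun u : 'rV[R]_n => \sum_i (u 0 i * k / 2) *: e i) => [v|u].
    rewrite [RHS]ex; apply: eq_bigr => i _; rewrite gE mulfVK //.
  apply/rowP => j; rewrite gE.
  have -> : pairing f (\sum_i (u 0 i * k / 2) *: e i) (e j) =
            \sum_i (u 0 i * k / 2) * pairing f (e i) (e j).
    rewrite /pairing form_suml mulr_sumr mulr_suml; apply: eq_bigr => i _.
    by rewrite formZl; ring.
  rewrite (bigD1 j) //= big1 => [|i ij]; last first.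
    by rewrite frame_pairing (negPf ij) mul0r mulr0.
  rewrite frame_pairing eqxx mul1r addr0; field; exact: k0.
- apply/seteqP; split=> [_ [c Pc <-]|x].
    have [/Te[i [s ->]]|nTc] := pselect (T c).
      by left; exists i, s; rewrite linearZ ge.
    have [/eqP/cards2P[i [j [ij sup]]] sq] := nT Pc nTc.
    have ci : i \in frame_support c by rewrite sup !inE eqxx.
    have cj : j \in frame_support c by rewrite sup !inE eqxx orbT.
    rewrite !inE in ci cj.
    have [s si] := sqr_sign (sq i ci).
    have [t tj] := sqr_sign (sq j cj).
    by right; exists i, j, s, t; split=> //; exact: two.
  move=> [[i [s ->]]|[i [j [s [t [ij ->]]]]]].
    exists ((-1) ^+ s *: e i); last by rewrite linearZ ge.
    have Pi := frame_root i.
    by case: s; rewrite ?scaleN1r ?scale1r //; exact: (rootN rs).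
  have flip l l' c : l != l' -> pairing f (refl f (e l) c) (e l') = pairing f c (e l').
    move=> ll; rewrite /refl pairingBl pairingZl frame_pairing (negPf ll).
    by rewrite mul0r mulr0 subr0.
  have self l c : pairing f (refl f (e l) c) (e l) = - pairing f c (e l).
    exact: pairing_refl (root_nz rs (frame_root l)).
  have supp l c : frame_support (refl f (e l) c) = frame_support c.
    apply/setP => l'; rewrite !inE; have [<-|ll'] := eqVneq l l'.
      by rewrite self oppr_eq0.
    by rewrite flip.
  have [c [Pc ci cj]] : exists c, [/\ Phi0 c, f c (e i) != 0 & f c (e j) != 0].
    apply: (common_neighbour rs hred hirr); rewrite ?eL //; exact: frame_root.
  rewrite -(pairing_eq0 f) ?(root_nz rs (frame_root i)) // in ci.
  rewrite -(pairing_eq0 f) ?(root_nz rs (frame_root j)) // in cj.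
  have nTc : ~ T c.
    move=> /Te[l [b cE]]; move: ci cj.
    rewrite cE !pairingZl !frame_pairing.
    have [->|_] := eqVneq l i; last by rewrite mul0r mulr0 eqxx.
    by rewrite (negPf ij) mul0r mulr0 eqxx.
  have [card2 sq] := nT Pc nTc.
  have sup : frame_support c = [set i; j]%SET.
    apply/esym/eqP; rewrite eqEcard card2 cards2 ij /= andbT.
    by apply/fintype.subsetP => l; rewrite !inE => /orP[]/eqP->.
  have [s' si] := sqr_sign (sq i ci).
  have [t' tj] := sqr_sign (sq j cj).
  have {si ci sq card2 nTc} [d [Pd dsup di dj]] :
      exists d, [/\ Phi0 d, frame_support d = [set i; j]%SET,
        pairing f d (e i) = (-1) ^+ s * k & pairing f d (e j) = (-1) ^+ t' * k].
    have [<-|ss] := eqVneq s' s; first by exists c.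
    exists (refl f (e i) c); split.
    - exact: (root_refl rs (frame_root i)).
    - by rewrite supp.
    - by rewrite self si; case: (s) (s') ss => -[] //= _; ring.
    - by rewrite flip.
  have {dj} [d' [Pd' d'sup d'i d'j]] :
      exists d, [/\ Phi0 d, frame_support d = [set i; j]%SET,
        pairing f d (e i) = (-1) ^+ s * k & pairing f d (e j) = (-1) ^+ t * k].
    have [<-|tt] := eqVneq t' t; first by exists d.
    exists (refl f (e j) d); split.
    - exact: (root_refl rs (frame_root j)).
    - by rewrite supp.
    - by rewrite flip // eq_sym.
    - by rewrite self dj; case: (t) (t') tt => -[] //= _; ring.
  by exists d' => //; exact: two.
- move=> a b Pa Pb.
  have dotE x y : std_dot (gL x) (gL y) * (k ^+ 2 * L) = 4 * f x y.
    rewrite frame_form /std_dot mxE mulr_suml mulr_sumr; apply: eq_bigr => i _.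
    rewrite [(_^T) _ _]mxE !gE; field; exact: k0.
  have fa := root_gt0 rs Pa.
  have kL : k ^+ 2 * L != 0.
    apply: contraTneq fa => kL; have := dotE a a; rewrite kL mulr0 => E.
    by rewrite -leNgt; lra.
  have Ea := dotE a a; have Eba := dotE b a.
  have sa : std_dot (gL a) (gL a) != 0.
    by apply: contraTneq fa => s0; rewrite s0 mul0r in Ea; rewrite -leNgt; lra.
  rewrite /pairing.
  have -> : f a a = std_dot (gL a) (gL a) * (k ^+ 2 * L) / 4 by rewrite Ea; field.
  have -> : f b a = std_dot (gL b) (gL a) * (k ^+ 2 * L) / 4 by rewrite Eba; field.
  have L0 : L != 0 by apply: contraNneq kL => ->; rewrite mulr0.
  by field; rewrite sa L0 k0.
Qed.
End Frame.

Section ClassicalTypes.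
Context {R : realType} {V : vectType R} {f : {dot V for idfun}} {Phi0 : set V}.
Context (rs : root_system f Phi0) (hred : reduced Phi0) (hirr : irreducible f Phi0).
Context (m : nat) (hm : lacing_number f Phi0 m).
Local Notation short := (short_roots f Phi0).
Local Notation long := (long_roots f Phi0).

Lemma frame_size2 (T : set V) n (e : 'I_n -> V) c :
  #|frame_support f e c| = 2%N -> (2 <= n)%N.
Proof. by move=> <-; rewrite -[X in (_ <= X)%N]card_ord max_card. Qed.

(** Without such a pair the short roots form a frame. If m = 1 these are all
    roots, and irreducibility leaves one pair of them. If m > 1, a long root has
    coordinates 0, m or -m with respect to the short coroots; the number of
    nonzero ones times m is 4, so m = 2 and the system is of type B. *)
Lemma short_a2_or_type_B : ~ type_A1 Phi0 -> ~ type_B f Phi0 ->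
  a2_pair f short.
Proof.
move=> nA nB; apply: contrapT => no.
have [a0 [b0 [sa0 lb0 _]]] := hm.
have sP : short `<=` Phi0 by move=> ? [].
have orth := no_a2_pair rs hred sP (shortN rs) (@short_form _ _ _ _) no.
have mb := lacing_bounds rs hred hirr hm.
have [m1|m2] : m = 1%N \/ (1 < m)%N by lia.
  apply: nA; exists a0; first exact: (root_nz rs sa0.1).
  have sall c : Phi0 c -> short c by case/(simply_laced hm m1).
  apply/seteqP; split=> [b Pb|b [->|->]]; last 2 first.
  - exact: sa0.1.
  - exact: (rootN rs sa0.1).
  have ab : f a0 a0 = f b b by apply: short_form sa0 (sall _ Pb).
  have [c [Pc ca cb]] := common_neighbour rs hred hirr sa0.1 Pb ab.
  have := orth _ _ (sall _ Pc) (sall _ Pb) cb.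
  have := orth _ _ (sall _ Pc) sa0 ca.
  move=> [->|->] [->|->]; rewrite /= ?opprK; by [left|right].
have [n [e fr]] := orthogonal_frame rs hirr sP (ex_intro _ a0 sa0) (short_refl rs) orth.
have es i : short (e i) by case: fr.
have eL i : f (e i) (e i) = f a0 a0 by apply: short_form.
have m0 : m%:R != 0 :> R by rewrite pnatr_eq0; lia.
have sq c : Phi0 c -> ~ short c -> forall i, pairing f c (e i) != 0 ->
    pairing f c (e i) ^+ 2 = m%:R ^+ 2.
  move=> Pc nsc i ci; have [//|lc] := short_or_long rs hred hirr hm Pc.
  rewrite (long_short_pairing rs hm (es i) lc).
  rewrite pairing_eq0 ?(root_nz rs (es i).1) // formC in ci.
  by have [->|->] := short_long_pm1 rs hred hm m2 (es i) lc ci; ring.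
have main c : Phi0 c -> ~ short c -> m = 2%N /\ #|frame_support f e c| = 2%N.
  move=> Pc nsc; have [//|lc] := short_or_long rs hred hirr hm Pc.
  have := frame_norm rs sP fr eL (sq _ Pc nsc).
  rewrite (lacing_form hm sa0 lc) => E.
  have : 4 * m%:R = #|frame_support f e c|%:R * m%:R ^+ 2 :> R.
    by apply: (mulIf (lt0r_neq0 (root_gt0 rs sa0.1))); rewrite [RHS]mulrC -E mulrA.
  rewrite -[4]/(4%:R) -natrX -!natrM => /eqP; rewrite eqr_nat => /eqP.
  by case: (m) mb m2 => [|[|[|[|]]]] //= _ _; lia.
have nT c : Phi0 c -> ~ short c -> #|frame_support f e c| = 2%N /\
    forall i, pairing f c (e i) != 0 -> pairing f c (e i) ^+ 2 = m%:R ^+ 2.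
  by move=> Pc nsc; split; [exact: (main c Pc nsc).2|exact: sq].
have nsb0 : ~ short b0 by move=> /(short_not_long rs hm m2); apply.
have [mE card2] := main _ lb0.1 nsb0.
apply: nB; exists n; first exact: frame_size2 card2.
have := frame_iso rs hred hirr sP fr eL m0 nT.
suff -> : frame_roots (n := n) (m%:R : R) = @roots_B R n by [].
rewrite /frame_roots /roots_B mE divff ?pnatr_eq0 //; congr (_ `|` _).
by apply/seteqP; split=> x [i [s ->]]; exists i, s; rewrite scale1r.
Qed.

(** The same count with a frame of long roots: a short root has coordinates 0, 1
    or -1, and again the number of nonzero ones times m is 4. *)
Lemma long_a2_or_type_C : (1 < m)%N -> ~ a2_pair f long ->
  m = 2%N /\ type_C f Phi0.
Proof.
move=> m2 no; have [a0 [b0 [sa0 lb0 _]]] := hm.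
have lP : long `<=` Phi0 by move=> ? [].
have orth := no_a2_pair rs hred lP (longN rs) (@long_form _ _ _ _) no.
have mb := lacing_bounds rs hred hirr hm.
have [n [e fr]] := orthogonal_frame rs hirr lP (ex_intro _ b0 lb0) (long_refl rs) orth.
have el i : long (e i) by case: fr.
have eL i : f (e i) (e i) = f b0 b0 by apply: long_form.
have sq c : Phi0 c -> ~ long c -> forall i, pairing f c (e i) != 0 ->
    pairing f c (e i) ^+ 2 = 1 ^+ 2.
  move=> Pc nlc i ci; have [sc|//] := short_or_long rs hred hirr hm Pc.
  rewrite pairing_eq0 ?(root_nz rs (el i).1) // in ci.
  by have [->|->] := short_long_pm1 rs hred hm m2 sc (el i) ci; ring.
have main c : Phi0 c -> ~ long c -> m = 2%N /\ #|frame_support f e c| = 2%N.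
  move=> Pc nlc; have [sc|//] := short_or_long rs hred hirr hm Pc.
  have := frame_norm rs lP fr eL (sq _ Pc nlc).
  rewrite (lacing_form hm sc lb0) expr1n mulr1 => E.
  have : 4 = m%:R * #|frame_support f e c|%:R :> R.
    apply: (mulIf (lt0r_neq0 (root_gt0 rs sc.1))); rewrite E; ring.
  rewrite -[4]/(4%:R) -!natrM => /eqP; rewrite eqr_nat => /eqP.
  by case: (m) mb m2 => [|[|[|[|]]]] //= _ _; lia.
have nT c : Phi0 c -> ~ long c -> #|frame_support f e c| = 2%N /\
    forall i, pairing f c (e i) != 0 -> pairing f c (e i) ^+ 2 = 1 ^+ 2.
  by move=> Pc nlc; split; [exact: (main c Pc nlc).2|exact: sq].
have nla0 := short_not_long rs hm m2 sa0.
have [mE card2] := main _ sa0.1 nla0.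
split=> //; exists n; first exact: frame_size2 card2.
have := frame_iso rs hred hirr lP fr eL (oner_neq0 R) nT.
by rewrite /frame_roots divr1.
Qed.

Lemma std_dotE n (u v : 'rV[R]_n) : std_dot u v = \sum_i u 0 i * v 0 i.
Proof. by rewrite /std_dot mxE; apply: eq_bigr => i _; rewrite [(_^T) _ _]mxE. Qed.

Lemma std_dot_ZeZe n (i j : 'I_n) (x y : R) :
  std_dot (x *: 'e_i) (y *: 'e_j) = x * y * (i == j)%:R.
Proof.
rewrite std_dotE (bigD1 i) //= big1 => [|l li].
  by rewrite !mxE !eqxx /= addr0; ring.
by rewrite !mxE (negPf li) /= mulr0 mul0r.
Qed.

Lemma std_dotDl n (u v w : 'rV[R]_n) : std_dot (u + v) w = std_dot u w + std_dot v w.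
Proof. by rewrite !std_dotE -big_split; apply: eq_bigr => i _; rewrite mxE mulrDl. Qed.

Lemma std_dotC n (u v : 'rV[R]_n) : std_dot u v = std_dot v u.
Proof. by rewrite !std_dotE; apply: eq_bigr => i _; rewrite mulrC. Qed.

(** An isomorphism preserves pairings only, but the two pairings of a pair of
    non-orthogonal roots give the ratio of their lengths. A root that goes to
    the sum or difference of two e_i is shorter than one that goes to 2 e_i, so
    the long roots go to multiples of the e_i. *)
Lemma type_C_no_long_a2 : type_C f Phi0 -> ~ a2_pair f long.
Proof.
move=> [n _ [g [_ gP gE]]] [a [b [la lb ab _]]].
have axis c : long c -> exists (i : 'I_n) (s : bool), g c = (-1) ^+ s *: (2 *: 'e_i).
  move=> lc; have : (@roots_C R n) (g c) by rewrite -gP; exists c => //; exact: lc.1.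
  case=> // -[i [j [s [t [ij gc]]]]]; exfalso.
  have [d Pd gd] : exists2 d, Phi0 d & g d = (-1) ^+ s *: (2 *: 'e_i).
    have : (@roots_C R n) ((-1) ^+ s *: (2 *: 'e_i)) by left; exists i, s.
    by rewrite -gP => -[d Pd gd]; exists d.
  have Ecd := gE _ _ lc.1 Pd; have Edc := gE _ _ Pd lc.1.
  have ss : (-1) ^+ s * (-1) ^+ s = 1 :> R by rewrite -signr_addb addbb.
  have tt : (-1) ^+ t * (-1) ^+ t = 1 :> R by rewrite -signr_addb addbb.
  have d1 : std_dot (g d) (g d) = 4.
    rewrite gd !scalerA std_dot_ZeZe eqxx mulr1.
    by transitivity (4 * ((-1) ^+ s * (-1) ^+ s) : R); [ring|rewrite ss mulr1].
  have d2 : std_dot (g c) (g d) = 2.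
    rewrite gc gd !scalerA std_dotDl !std_dot_ZeZe eqxx [j == i]eq_sym.
    rewrite (negPf ij) mulr0 addr0 !mulr1.
    by rewrite mulrA ss mul1r.
  have d3 : std_dot (g c) (g c) = 2.
    rewrite gc std_dotDl !(std_dotC _ (_ + _)) !std_dotDl !std_dot_ZeZe !eqxx !mulr1.
    by rewrite [j == i]eq_sym (negPf ij) !mulr0 ss tt; ring.
  have fc := root_gt0 rs lc.1; have fd := root_gt0 rs Pd.
  move: Ecd Edc; rewrite /pairing d1 d3 (std_dotC (g d)) d2 (formC f d c) => Ecd Edc.
  have le := lc.2 _ Pd.
  have E1 : 2 * f c d = 2 * f c c.
    apply: (mulIf (invr_neq0 (lt0r_neq0 fc))).
    by rewrite -Ecd !mulfK ?pnatr_eq0 ?lt0r_neq0.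
  have E2 : 2 * f c d = f d d.
    apply: (mulIf (invr_neq0 (lt0r_neq0 fd))).
    by rewrite -Edc divff ?lt0r_neq0 //; field.
  by move: le; rewrite -E2 E1 mulr_natl mulr2n gerDl leNgt fc.
have [i [s ga]] := axis _ la; have [j [t gb]] := axis _ lb.
have := gE _ _ lb.1 la.1.
rewrite ab /pairing ga gb !scalerA !std_dot_ZeZe eqxx.
have [_|_] := eqVneq i j; last first.
  by move/eqP; rewrite !(mulr0, mul0r) eq_sym oppr_eq0 oner_eq0.
by case: s t {ga gb axis gP gE} => -[]; rewrite ?expr0 ?expr1 !mulr1; lra.
Qed.
End ClassicalTypes.

(** * Integral linearity *)

Section Generated.
Context {W : zmodType}.

Lemma generated_subgroup (A : set W) : subgroup (generated A).
Proof.
split=> [B [[B0 _] _]//|x y Ax Ay B [sB AB]].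
by apply: subgroupB => //; [apply: Ax|apply: Ay].
Qed.

Lemma sub_generated (A : set W) : A `<=` generated A.
Proof. by move=> x Ax B [_]; apply. Qed.

Lemma generated_min (A B : set W) : subgroup B -> A `<=` B -> generated A `<=` B.
Proof. by move=> sB AB x; apply; split. Qed.
End Generated.

Section ZLinearity.
Context {R : realType} {V Y : vectType R} (f : {dot V for idfun}) (Phi0 : set V).
Context (rs : root_system f Phi0).

Lemma linear_Zlinear (p : {linear V -> Y}) : Zlinear Phi0 p.
Proof. by exists p => // x y _ _; rewrite linearD. Qed.

Lemma Zlinear_refl (p : V -> Y) a b : Zlinear Phi0 p -> Phi0 a -> Phi0 b ->
  p (refl f a b) = p b - pairing f b a *: p a.
Proof.
move=> [h hD hp] Pa Pb; have sG := generated_subgroup Phi0.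
have PG x : Phi0 x -> generated Phi0 x by exact: sub_generated.
have h0 : h 0 = 0.
  have [G0 _] := sG; have := hD 0 0 G0 G0.
  by rewrite addr0 => /esym/eqP; rewrite -subr_eq0 addrK => /eqP.
have hM n x : generated Phi0 x -> h (x *+ n) = h x *+ n /\ generated Phi0 (x *+ n).
  move=> Gx; elim: n => [|n [IH Gn]]; first by rewrite !mulr0n; split=> //; case: sG.
  by rewrite !mulrS hD // IH; split=> //; exact: (subgroupD sG).
have hN x : generated Phi0 x -> h (- x) = - h x.
  move=> Gx; have := hD x (- x) Gx (subgroupN sG Gx).
  by rewrite subrr h0 => /esym/eqP; rewrite addrC addr_eq0 => /eqP.
have hB x y : generated Phi0 x -> generated Phi0 y -> h (x - y) = h x - h y.
  by move=> Gx Gy; rewrite hD ?hN //; exact: (subgroupN sG).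
rewrite -(hp _ Pa) -(hp _ Pb) -(hp _ (root_refl rs Pa Pb)).
have [z zE] := root_intP rs Pa Pb.
rewrite /refl zE hB; [|exact: PG|]; last first.
  by apply: (subgroup_int sG); [apply/intrP; exists z|exact: PG].
congr (_ - _); rewrite !scaler_int.
case: z {zE} => n; first by rewrite -!pmulrn (hM _ _ (PG _ Pa)).1.
rewrite !NegzE !mulrNz hN; last exact: (hM _ _ (PG _ Pa)).2.
by rewrite -!pmulrn (hM _ _ (PG _ Pa)).1.
Qed.
End ZLinearity.

(** * Affine root subsystems *)

Section Affine.
Context {R : realType} {V Y : vectType R} {f : {dot V for idfun}}.
Context {Phi0 : set V} {Lam : V -> set Y}.
Context (rs : root_system f Phi0) (hred : reduced Phi0) (hirr : irreducible f Phi0).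
Context (hLam : extension_datum f Phi0 Lam).
Context (m : nat) (hm : lacing_number f Phi0 m) (hA2 : a2_pair f (short_roots f Phi0)).
Local Notation short := (short_roots f Phi0).
Local Notation long := (long_roots f Phi0).
Local Notation Ls := (Lam_s f Phi0 Lam).
Local Notation Ll := (Lam_l f Phi0 Lam).
Local Notation mLs := (dilate m%:R Ls).
Local Notation Phi := (affine_roots Phi0 Lam).
Local Notation subsystem := (root_subsystem (affine_form f) Phi).

Lemma extension_family : reflection_family f Phi0 Lam.
Proof.
split=> [a Pa|a b x y Pa Pb Lx Ly]; first by apply: (ext_0 hLam); left.
apply: (ext_refl hLam) => //; exists y => //.
by exists (- pairing f b a *: x); [exists x|rewrite scaleNr].
Qed.

Lemma Lam_sE a : short a -> Lam a = Ls.
Proof.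
move=> sa; apply/seteqP; split=> [y Ly|y [b sb Ly]]; first by exists a.
by rewrite (family_length rs hred hirr extension_family sa.1 sb.1 (short_form sa sb)).
Qed.

Lemma Lam_lE a : long a -> Lam a = Ll.
Proof.
move=> la; apply/seteqP; split=> [y Ly|y [b lb Ly]]; first by exists a.
by rewrite (family_length rs hred hirr extension_family la.1 lb.1 (long_form la lb)).
Qed.

Lemma short_inhabited : exists a, short a.
Proof. by have [a [b []]] := hm; exists a. Qed.

Lemma long_inhabited : exists a, long a.
Proof. by have [a [b []]] := hm; exists b. Qed.

Lemma Ls_subgroup : subgroup Ls.
Proof.
have [a sa] := short_inhabited; rewrite -(Lam_sE sa).
exact: (family_short_subgroup rs hred hirr extension_family).
Qed.

Lemma Ll0 : Ll 0.
Proof.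
have [a la] := long_inhabited; rewrite -(Lam_lE la).
exact: extension_family.1 la.1.
Qed.

Lemma Ll_sub_Ls : Ll `<=` Ls.
Proof.
have [a sa] := short_inhabited; have [b lb] := long_inhabited.
rewrite -(Lam_lE lb) -(Lam_sE sa).
exact: (family_long_short rs hred hirr extension_family hm).
Qed.

Lemma Ll_add x y : Ls x -> Ll y -> Ll (y + m%:R *: x).
Proof.
have [a sa] := short_inhabited; have [b lb] := long_inhabited.
rewrite -(Lam_lE lb) -(Lam_sE sa).
exact: (family_long_add rs hred hirr extension_family hm hA2).
Qed.

Lemma Ll_subgroup : a2_pair f long -> subgroup Ll.
Proof.
move=> lA2; have [a la] := long_inhabited; rewrite -(Lam_lE la).
exact: (family_long_subgroup rs hred hirr extension_family).
Qed.

Lemma mLs_sub_Ll : mLs `<=` Ll.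
Proof.
by move=> _ [x Lx <-]; rewrite -[_ *: _]add0r; apply: Ll_add => //; exact: Ll0.
Qed.

Lemma mLs_subgroup : subgroup mLs.
Proof.
have sL := Ls_subgroup; split=> [|_ _ [x Lx <-] [y Ly <-]].
  by exists 0; rewrite ?scaler0 //; case: sL.
by exists (x - y); rewrite ?scalerBr //; exact: subgroupB.
Qed.

Lemma simply_laced_mLs : m = 1%N -> Ll = mLs.
Proof.
move=> m1; apply/seteqP; split; last exact: mLs_sub_Ll.
by move=> y /Ll_sub_Ls Ly; exists y; rewrite // m1 scale1r.
Qed.

Lemma simply_laced_Lam : m = 1%N -> Ll = Ls.
Proof.
move=> m1; apply/seteqP; split; first exact: Ll_sub_Ls.
by move=> y Ly; apply: mLs_sub_Ll; exists y; rewrite // m1 scale1r.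
Qed.

Lemma roots_overP (T : set V) (A : V -> set Y) a y :
  roots_over T A (a, y) <-> T a /\ A a y.
Proof.
split=> [[b Tb [z Az [<- <-]]]|[Ta Ay]]; first by [].
by exists a => //; exists y.
Qed.

Lemma translateP (x y : Y) (A : set Y) : translate x A y <-> A (y - x).
Proof.
split=> [[a Aa <-]|Ay]; first by rewrite addrC addKr.
by exists (y - x); rewrite // addrC subrK.
Qed.

Lemma affine_refl a b (x y : Y) :
  refl (affine_form f) (a, x) (b, y) = (refl f a b, y - pairing f b a *: x).
Proof. by []. Qed.

Lemma subsystemP (Psi : set (V * Y)) :
  Psi !=set0 -> Psi `<=` Phi ->
  (forall a b x y, Psi (a, x) -> Psi (b, y) ->
     Psi (refl f a b, y - pairing f b a *: x)) ->
  subsystem Psi.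
Proof.
by move=> n0 sub cl; split=> // -[a x] [b y] ax bY; rewrite affine_refl; exact: cl.
Qed.

Section Subsystem.
Context (Psi : set (V * Y)) (sPsi : subsystem Psi).

Lemma subsystem_refl a b x y : Psi (a, x) -> Psi (b, y) ->
  Psi (refl f a b, y - pairing f b a *: x).
Proof. by move=> ax bY; case: sPsi => _ _ /(_ _ _ ax bY). Qed.

Lemma subsystem_root a x : Psi (a, x) -> Phi0 a /\ Lam a x.
Proof. by case: sPsi => _ sub _ /sub/roots_overP. Qed.

Context (onto : forall a, Phi0 a -> exists y, Psi (a, y)).

(** The reflection in a root (c, x) of Psi is an involution that preserves both
    Psi and the set of all affine roots. *)
Lemma full_orbit a b : Phi0 a -> weyl_orbit f Phi0 a b ->
  (forall y, Lam a y -> Psi (a, y)) -> forall y, Lam b y -> Psi (b, y).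
Proof.
move=> Pa; elim=> // c d Pc ad IH full y Ly.
have Pd := weyl_orbit_root rs Pa ad; have c0 := root_nz rs Pc.
have [x cx] := onto Pc; have [_ Lx] := subsystem_root cx.
have := extension_family.2 _ _ _ _ Pc (root_refl rs Pc Pd) Lx Ly.
rewrite reflK // pairing_refl // scaleNr opprK => Ld.
by have := subsystem_refl cx (IH full _ Ld); rewrite addrK.
Qed.

Lemma full_all a b : short a -> long b ->
  (forall y, Ls y -> Psi (a, y)) -> (forall y, Ll y -> Psi (b, y)) -> Phi `<=` Psi.
Proof.
move=> sa lb fa fb [c y] /roots_overP[Pc Ly].
have [sc|lc] := short_or_long rs hred hirr hm Pc.
  have ac := same_length_orbit rs hred hirr sa.1 Pc (short_form sa sc).
  by apply: (full_orbit sa.1 ac) => // z; rewrite (Lam_sE sa); exact: fa.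
have bc := same_length_orbit rs hred hirr lb.1 Pc (long_form lb lc).
by apply: (full_orbit lb.1 bc) => // z; rewrite (Lam_lE lb); exact: fb.
Qed.

Lemma subsystem_section : exists p : V -> Y,
  Zlinear Phi0 p /\ forall a, Phi0 a -> Psi (a, p a).
Proof.
have [||p pP] := linear_section (Z := fun a => [set y | Psi (a, y)]) rs hred.
- by move=> a /onto[y ay]; exists y.
- by move=> a b x y Pa Pb; exact: subsystem_refl.
by exists p; split=> //; exact: linear_Zlinear.
Qed.
End Subsystem.

(** A subsystem with section p is the union of the cosets p_a + H over the short
    roots and of the translates p_a + S over the long roots. *)
Record coset_data (Psi : set (V * Y)) (p : V -> Y) (H S : set Y) : Prop := CosetData {
  data_subgroup : subgroup H;
  data_sub : H `<=` Ls;
  data_0 : S 0;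
  data_long_short : S `<=` H;
  data_add : forall x y, H x -> S y -> S (y + m%:R *: x);
  data_long_subgroup : a2_pair f long -> subgroup S;
  data_short : forall a y, short a -> Psi (a, y) <-> H (y - p a);
  data_long : forall a y, long a -> Psi (a, y) <-> S (y - p a)
}.

Lemma subsystem_data Psi p : subsystem Psi -> Zlinear Phi0 p ->
  (forall a, Phi0 a -> Psi (a, p a)) -> exists H S, coset_data Psi p H S.
Proof.
move=> sPsi pZ pPsi.
pose Z a := [set y | Psi (a, p a + y)].
have fZ : reflection_family f Phi0 Z.
  split=> [a Pa|a b x y Pa Pb Zx Zy]; first by rewrite /Z /= addr0; exact: pPsi.
  rewrite /Z /= (Zlinear_refl rs pZ Pa Pb).
  have := subsystem_refl sPsi Zx Zy.
  by rewrite scalerDr opprD addrACA.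
have [a0 sa0] := short_inhabited; have [b0 lb0] := long_inhabited.
exists (Z a0), (Z b0); split.
- exact: (family_short_subgroup rs hred hirr fZ).
- move=> y Zy; have [_] := subsystem_root sPsi Zy.
  have [_] := subsystem_root sPsi (pPsi _ sa0.1).
  rewrite (Lam_sE sa0) => Lp Lpy.
  by have := subgroupB Ls_subgroup Lpy Lp; rewrite addrC addKr.
- exact: fZ.1 lb0.1.
- exact: (family_long_short rs hred hirr fZ hm).
- by move=> x y; exact: (family_long_add rs hred hirr fZ hm hA2).
- by move=> lA2; exact: (family_long_subgroup rs hred hirr fZ).
- move=> a y sa.
  rewrite -(family_length rs hred hirr fZ sa.1 sa0.1 (short_form sa sa0)).
  by rewrite /Z /= addrC subrK.
- move=> a y la.
  rewrite -(family_length rs hred hirr fZ la.1 lb0.1 (long_form la lb0)).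
  by rewrite /Z /= addrC subrK.
Qed.

(** * Constructions of subsystems *)

(** In this form the closure under m H is used for a long root reflected in a
    short one, as the pairing is then an integer multiple of m. *)
Lemma lacing_multiple_closed (S H : set Y) (z : R) x y : subgroup H ->
  (forall x y, H x -> S y -> S (y + m%:R *: x)) -> z \is a Num.int ->
  H x -> S y -> S (y - (m%:R * z) *: x).
Proof.
move=> sH add zi Hx Sy; rewrite -scalerA -scalerN; apply: add => //.
by apply: subgroupN => //; exact: subgroup_int.
Qed.

(** For m > 1 and a Z-linear p with values in the fibres of the extension datum,
    these conditions make Lambda_s over the short roots and p_a + S over the
    long roots a root subsystem. *)
Record short_full_data (p : V -> Y) (S : set Y) : Prop := ShortFullData {
  sf_0 : S 0;
  sf_sub : S `<=` Ls;
  sf_add : forall x y, Ls x -> S y -> S (y + m%:R *: x);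
  sf_subgroup : a2_pair f long -> subgroup S;
  sf_Ll : forall a, long a -> translate (p a) S `<=` Ll
}.

Definition short_full (p : V -> Y) (S : set Y) : set (V * Y) :=
  roots_over short (fun=> Ls) `|` roots_over long (fun a => translate (p a) S).

Definition long_full (p : V -> Y) (H : set Y) : set (V * Y) :=
  roots_over short (fun a => translate (p a) H) `|` roots_over long (fun=> Ll).

Definition coset_roots (p : V -> Y) (H : set Y) : set (V * Y) :=
  roots_over short (fun a => translate (p a) H) `|`
  roots_over long (fun a => translate (p a) H `&` Ll).

Lemma short_fullP p S a y : short_full p S (a, y) <->
  (short a /\ Ls y) \/ (long a /\ S (y - p a)).
Proof.
rewrite /short_full; split=> [[/roots_overP|/roots_overP[la /translateP]]|].
- by left.
- by right.
- case=> [[sa ?]|[la ?]]; [left|right]; apply/roots_overP; split=> //;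
    exact/translateP.
Qed.

Lemma long_fullP p H a y : long_full p H (a, y) <->
  (short a /\ H (y - p a)) \/ (long a /\ Ll y).
Proof.
rewrite /long_full; split=> [[/roots_overP[sa /translateP]|/roots_overP]|].
- by left.
- by right.
- case=> [[sa ?]|[la ?]]; [left|right]; apply/roots_overP; split=> //;
    exact/translateP.
Qed.

Lemma coset_rootsP p H a y : subgroup H -> H `<=` Ls ->
  (forall a, Phi0 a -> Lam a (p a)) ->
  coset_roots p H (a, y) <-> Phi (a, y) /\ H (y - p a).
Proof.
move=> sH HLs pL; rewrite /coset_roots; split.
- case=> /roots_overP[xa]; last first.
    move=> [/translateP Hy Ly]; split=> //; apply/roots_overP; split; first exact: xa.1.
    by rewrite (Lam_lE xa).
  move=> /translateP Hy; split=> //; apply/roots_overP; split; first exact: xa.1.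
  rewrite (Lam_sE xa) -[y](subrK (p a)).
  apply: (subgroupD Ls_subgroup); first exact: HLs.
  by rewrite -(Lam_sE xa); apply: pL; exact: xa.1.
- move=> [/roots_overP[Pa Ly] Hy].
  have [sa|la] := short_or_long rs hred hirr hm Pa.
    by left; apply/roots_overP; split=> //; apply/translateP.
  right; apply/roots_overP; split=> //; split; first exact/translateP.
  by rewrite -(Lam_lE la).
Qed.

Section MultiplyLaced.
Context (m2 : (1 < m)%N).

(** If S is not a subgroup, then the system is of type C and m = 2, and two long
    roots are orthogonal or proportional. Their pairing is therefore 0, 2 or -2,
    and closure under 2 Lambda_s suffices. *)
Lemma long_reflection_closed a b (S : set Y) x y : S `<=` Ls ->
  (forall x y, Ls x -> S y -> S (y + m%:R *: x)) ->
  (a2_pair f long -> subgroup S) -> long a -> long b -> S x -> S y ->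
  S (y - pairing f b a *: x).
Proof.
move=> SL Sadd SG la lb Sx Sy.
have ki := root_int rs la.1 lb.1.
have [lA2|nA2] := pselect (a2_pair f long).
  by apply: (subgroupB (SG lA2)) => //; exact: (subgroup_int (SG lA2)).
have [mE _] := long_a2_or_type_C rs hred hirr hm m2 nA2.
have mul (z : R) : z \is a Num.int -> S (y - (m%:R * z) *: x).
  by move=> zi; apply: (lacing_multiple_closed Ls_subgroup) => //; exact: SL.
have [ba|ba] := eqVneq (f b a) 0.
  by rewrite /pairing ba mulr0 mul0r scale0r subr0.
have b0 := root_nz rs lb.1.
have lP : long `<=` Phi0 by move=> ? [].
have := no_a2_pair rs hred lP (longN rs) (@long_form _ _ _ _) nA2 lb la ba.
case=> ->.
  rewrite pairing_self //; have := mul 1 (rpred1 _); by rewrite mulr1 mE.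
rewrite pairingNr pairing_self //.
by have := mul (-1) (rpredN1 _); rewrite mulrN1 mE.
Qed.

Lemma shiftE (x y u v : Y) (k : R) :
  y - k *: x - (v - k *: u) = (y - v) - k *: (x - u).
Proof.
by rewrite scalerBr !opprB [_ - v]addrC addrACA [- (k *: x) + _]addrC.
Qed.

Lemma short_full_subsystem p S : Zlinear Phi0 p ->
  (forall a, Phi0 a -> Lam a (p a)) -> short_full_data p S ->
  subsystem (short_full p S).
Proof.
move=> pZ pL [S0 SL Sadd SG SLl].
have [a0 sa0] := short_inhabited.
apply: subsystemP.
- exists (a0, 0); apply/short_fullP; left; split=> //; exact: Ls_subgroup.1.
- move=> [a y] /short_fullP[[sa Ly]|[la Sy]]; apply/roots_overP.
    by rewrite (Lam_sE sa); split=> //; exact: sa.1.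
  rewrite (Lam_lE la); split; first exact: la.1.
  by apply: (SLl _ la); apply/translateP.
move=> a b x y /short_fullP ax /short_fullP yb; apply/short_fullP.
have Pa : Phi0 a by case: ax => -[[]].
have xL : Ls x.
  case: ax => [[]//|[la Sx]]; apply: Ll_sub_Ls; apply: (SLl _ la); exact/translateP.
case: yb => [[sb Ly]|[lb Sy]].
  left; split; first exact: (short_refl rs Pa sb).
  apply: (subgroupB Ls_subgroup) => //; apply: (subgroup_int Ls_subgroup) => //.
  exact: (root_int rs Pa sb.1).
right; split; first exact: (long_refl rs Pa lb).
rewrite (Zlinear_refl rs pZ Pa lb.1) shiftE.
case: ax => [[sa _]|[la Sx]]; last exact: long_reflection_closed.
rewrite (long_short_pairing rs hm sa lb).
apply: (lacing_multiple_closed Ls_subgroup) => //.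
  exact: (root_int rs lb.1 Pa).
by apply: (subgroupB Ls_subgroup) => //; rewrite -(Lam_sE sa); exact: pL.
Qed.

End MultiplyLaced.

Lemma long_full_subsystem p H : Zlinear Phi0 p ->
  (forall a, Phi0 a -> Lam a (p a)) -> subgroup H -> Ll `<=` H -> H `<=` Ls ->
  subsystem (long_full p H).
Proof.
move=> pZ pL sH LlH HLs.
have [b0 lb0] := long_inhabited.
have pLs a : Phi0 a -> Ls (p a).
  move=> Pa; have [sa|la] := short_or_long rs hred hirr hm Pa.
    by rewrite -(Lam_sE sa); exact: pL.
  by apply: Ll_sub_Ls; rewrite -(Lam_lE la); exact: pL.
have sL := Ls_subgroup.
apply: subsystemP.
- by exists (b0, 0); apply/long_fullP; right; split=> //; exact: Ll0.
- move=> [a y] /long_fullP[[sa Hy]|[la Ly]]; apply/roots_overP.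
    rewrite (Lam_sE sa); split; first exact: sa.1.
    rewrite -[y](subrK (p a)); apply: (subgroupD sL); first exact: HLs.
    exact: pLs sa.1.
  by rewrite (Lam_lE la); split=> //; exact: la.1.
move=> a b x y /long_fullP ax /long_fullP yb; apply/long_fullP.
have Pa : Phi0 a by case: ax => -[[]].
have xH : H (x - p a).
  case: ax => [[]//|[la Lx]]; apply: (subgroupB sH); apply: LlH => //.
  by rewrite -(Lam_lE la); exact: pL.
case: yb => [[sb Hy]|[lb Ly]].
  left; split; first exact: (short_refl rs Pa sb).
  rewrite (Zlinear_refl rs pZ Pa sb.1) shiftE; apply: (subgroupB sH) => //.
  apply: (subgroup_int sH) => //; exact: (root_int rs Pa sb.1).
right; split; first exact: (long_refl rs Pa lb).
case: ax => [[sa _]|[la Lx]].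
  rewrite (long_short_pairing rs hm sa lb).
  apply: (lacing_multiple_closed sL) => //.
  - exact: Ll_add.
  - exact: (root_int rs lb.1 Pa).
  - rewrite -[x](subrK (p a)); apply: (subgroupD sL); first exact: HLs.
    exact: pLs.
rewrite -(Lam_lE (long_refl rs Pa lb)).
by apply: extension_family.2 Pa lb.1 _ _; rewrite Lam_lE.
Qed.

(** The affine roots (a, y) with y - p_a in H: by Z-linearity of p and because
    the pairings are integers, this condition is stable under reflections. *)
Lemma coset_roots_subsystem p H : Zlinear Phi0 p ->
  (forall a, Phi0 a -> Lam a (p a)) -> subgroup H -> H `<=` Ls ->
  subsystem (coset_roots p H).
Proof.
move=> pZ pL sH HLs; have [a0 sa0] := short_inhabited.
have cP := coset_rootsP _ _ sH HLs pL.
apply: subsystemP.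
- exists (a0, p a0); apply/cP; rewrite subrr; split; last exact: sH.1.
  by apply/roots_overP; split; [exact: sa0.1|apply: pL; exact: sa0.1].
- by move=> [a y] /cP[].
move=> a b x y /cP[/roots_overP[Pa Lx] Hx] /cP[/roots_overP[Pb Ly] Hy].
apply/cP; split.
  by apply/roots_overP; split; [exact: (root_refl rs)|exact: extension_family.2].
rewrite (Zlinear_refl rs pZ Pa Pb) shiftE; apply: (subgroupB sH) => //.
by apply: (subgroup_int sH) => //; exact: (root_int rs Pa Pb).
Qed.

Definition lift (G : set V) : set (V * Y) := [set x | Phi x /\ G x.1].

Lemma lift_subsystem G : root_subsystem f Phi0 G -> subsystem (lift G).
Proof.
move=> [[a Ga] GP Grefl]; apply: subsystemP.
- exists (a, 0); split=> //; apply/roots_overP; split; first exact: GP.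
  by apply: extension_family.1; exact: GP.
- by move=> x [].
move=> b c x y [/roots_overP[Pb Lx] Gb] [/roots_overP[Pc Ly] Gc].
split; last exact: Grefl.
by apply/roots_overP; split; [exact: (root_refl rs)|exact: extension_family.2].
Qed.

Lemma Gr_subsystem Psi : subsystem Psi -> root_subsystem f Phi0 (Gr Phi0 Lam Psi).
Proof.
move=> sPsi; have [[[a x] ax] _ _] := sPsi; split.
- by exists a; have [Pa Lx] := subsystem_root sPsi ax; split=> //; exists x.
- by move=> b [].
move=> b c [Pb [y Ly bY]] [Pc [z Lz cz]]; split; first exact: (root_refl rs).
have yb := subsystem_refl sPsi bY cz.
by eexists; last exact: yb; case: (subsystem_root sPsi yb).
Qed.

Lemma GrP Psi a : subsystem Psi -> Gr Phi0 Lam Psi a <-> exists y, Psi (a, y).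
Proof.
move=> sPsi; split=> [[_ [y _ ay]]|[y ay]]; first by exists y.
by have [Pa Ly] := subsystem_root sPsi ay; split=> //; exists y.
Qed.

Lemma maximalP Psi : maximal_root_subsystem (affine_form f) Phi Psi <->
  [/\ subsystem Psi, ~ Phi `<=` Psi &
     forall Psi', subsystem Psi' -> Psi `<=` Psi' -> ~ Phi `<=` Psi' -> Psi' `<=` Psi].
Proof.
split=> [[sPsi [sub n] max]|[sPsi n max]]; split=> //.
  move=> Psi' sPsi' sub' n'; apply: contrapT => n2; apply: (max Psi') => //.
  by split=> //; case: sPsi'.
  by split=> //; case: sPsi.
by move=> Psi' sPsi' [_ n'] [sub n2]; apply: n2; exact: max.
Qed.

(** * Sufficient conditions for maximality *)

Lemma multiply_laced : Ll <> mLs -> (1 < m)%N.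
Proof.
move=> n; have mb := lacing_bounds rs hred hirr hm.
have [m1|//] : m = 1%N \/ (1 < m)%N by lia.
by case: n; exact: simply_laced_mLs.
Qed.

Lemma mLs_sub_Ls : mLs `<=` Ls.
Proof. by move=> y /mLs_sub_Ll/Ll_sub_Ls. Qed.

Lemma short_full_of_subgroup p K : (forall a, long a -> Ll (p a)) ->
  a2_pair f long -> subgroup K -> mLs `<=` K -> K `<=` Ll -> short_full_data p K.
Proof.
move=> pL lA2 sK mK KL; split=> //; first exact: sK.1.
- by move=> y /KL/Ll_sub_Ls.
- by move=> x y Lx Ky; apply: (subgroupD sK) => //; apply: mK; exists x.
- move=> a la y /translateP Ky; rewrite -[y](subrK (p a)).
  by apply: (subgroupD (Ll_subgroup lA2)); [exact: KL|exact: pL].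
Qed.

Lemma short_full_of_cosets p S : ~ a2_pair f long ->
  admissible_coset_union long p mLs Ls Ll S -> short_full_data p S.
Proof.
move=> nA2 [[T TL ->] MS adm]; have sL := Ls_subgroup; split=> //.
- by apply: MS; exact: mLs_subgroup.1.
- move=> _ [x Tx [_ [y Ly <-] <-]]; apply: (subgroupD sL); first exact: TL.
  by apply: mLs_sub_Ls; exists y.
- move=> u _ Lu [x Tx [_ [y Ly <-] <-]]; exists x => //.
  exists (m%:R *: (y + u)); last by rewrite scalerDr addrA.
  by exists (y + u) => //; exact: (subgroupD sL).
- by move=> a la; case: (adm a la).
Qed.

Lemma cosets_of_data p S : S `<=` Ls -> S 0 ->
  (forall x y, Ls x -> S y -> S (y + m%:R *: x)) ->
  (forall a, long a -> translate (p a) S `<` Ll) ->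
  admissible_coset_union long p mLs Ls Ll S.
Proof.
move=> SL S0 Sadd adm; split=> //.
- exists S => //; apply/seteqP; split=> [y Sy|_ [x Sx [_ [y Ly <-] <-]]].
    exists y => //; exists 0; last by rewrite addr0.
    exact: mLs_subgroup.1.
  exact: Sadd.
- by move=> _ [x Lx <-]; rewrite -[_ *: _]add0r; exact: Sadd.
Qed.

Section SectionData.
Context (Psi : set (V * Y)) (p : V -> Y) (sPsi : subsystem Psi).
Context (pPsi : forall a, Phi0 a -> Psi (a, p a)).

Lemma section_Lam a : Phi0 a -> Lam a (p a).
Proof. by move=> Pa; case: (subsystem_root sPsi (pPsi Pa)). Qed.

Lemma section_Ls a : short a -> Ls (p a).
Proof. by move=> sa; rewrite -(Lam_sE sa); apply: section_Lam; exact: sa.1. Qed.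

Lemma section_Ll a : long a -> Ll (p a).
Proof. by move=> la; rewrite -(Lam_lE la); apply: section_Lam; exact: la.1. Qed.

Lemma section_onto a : Phi0 a -> exists y, Psi (a, y).
Proof. by move=> Pa; exists (p a); exact: pPsi. Qed.

Context (H S : set Y) (D : coset_data Psi p H S).

Lemma data_full_short :
  (exists2 a, short a & forall y, Ls y -> Psi (a, y)) -> Ls `<=` H.
Proof.
move=> [a sa full] y Ly.
have : Psi (a, p a + y).
  by apply: full; apply: (subgroupD Ls_subgroup) => //; exact: section_Ls.
by move/(data_short D _ sa); rewrite addrC addKr.
Qed.

Lemma data_short_full a y : Ls `<=` H -> short a -> Ls y -> Psi (a, y).
Proof.
move=> LH sa Ly; apply/(data_short D _ sa); apply: LH.
by apply: (subgroupB Ls_subgroup) => //; exact: section_Ls.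
Qed.

(** By [full_orbit] it is enough that the fibre over one long root is full. *)
Lemma data_full_all b : Ls `<=` H -> long b -> (forall y, Ll y -> S (y - p b)) ->
  Phi `<=` Psi.
Proof.
move=> LH lb full; have [a sa] := short_inhabited.
apply: (full_all sPsi section_onto sa lb) => y Ly; first exact: data_short_full.
by apply/(data_long D _ lb); exact: full.
Qed.

Lemma data_proper a : Ls `<=` H -> ~ Phi `<=` Psi -> long a ->
  translate (p a) S `<` Ll.
Proof.
move=> LH n la; split=> [y /translateP Sy|full].
  have /(data_long D _ la) ay := Sy.
  by rewrite -(Lam_lE la); case: (subsystem_root sPsi ay).
by apply: n; apply: (data_full_all LH la) => y /full/translateP.
Qed.

Lemma data_sub_Ll : a2_pair f long -> S `<=` Ll.
Proof.
move=> lA2 y Sy; have [b lb] := long_inhabited.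
have := (data_long D (p b + y) lb).2; rewrite addrC addKr => /(_ Sy) yb.
have [_] := subsystem_root sPsi yb; rewrite (Lam_lE lb) addrC => L.
rewrite -[y](addrK (p b)); apply: (subgroupB (Ll_subgroup lA2)) => //.
exact: section_Ll.
Qed.

End SectionData.

(** Every larger subsystem contains the section p, and so it has coset data
    over the same p. *)
Lemma section_maximal Psi p : subsystem Psi -> Zlinear Phi0 p ->
  (forall a, Phi0 a -> Psi (a, p a)) -> ~ Phi `<=` Psi ->
  (forall Psi' H S, subsystem Psi' -> Psi `<=` Psi' -> ~ Phi `<=` Psi' ->
     (forall a, Phi0 a -> Psi' (a, p a)) -> coset_data Psi' p H S ->
     Psi' `<=` Psi) ->
  maximal_root_subsystem (affine_form f) Phi Psi.
Proof.
move=> sPsi pZ pPsi n max; apply/maximalP; split=> // Psi' sPsi' sub n'.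
have pPsi' a : Phi0 a -> Psi' (a, p a) by move=> Pa; apply: sub; exact: pPsi.
have [H [S D]] := subsystem_data sPsi' pZ pPsi'.
exact: max sPsi' sub n' pPsi' D.
Qed.

(** A larger proper subsystem also has a full short part. Its long part S' is
    then one of the sets among which S is maximal: a proper subgroup of Lambda_l
    if two long roots span an A_2, and an admissible union of cosets in type C. *)
Lemma short_full_maximal p S :
  Zlinear Phi0 p -> (forall a, Phi0 a -> short_full p S (a, p a)) ->
  (forall a, Phi0 a -> Lam a (p a)) ->
  Ll <> mLs -> (forall a, long a -> translate (p a) S `<=` Ll) ->
  (~ type_C f Phi0 -> maximal_subgroup Ll S /\ mLs `<=` S) ->
  (type_C f Phi0 -> maximal_coset_union long p mLs Ls Ll S) ->
  maximal_root_subsystem (affine_form f) Phi (short_full p S).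
Proof.
move=> pZ pPsi pL nLl SLl SnC SC; have m2 := multiply_laced nLl.
have pLl a : long a -> Ll (p a).
  by move=> la; rewrite -(Lam_lE la); apply: pL; exact: la.1.
have nC : a2_pair f long -> ~ type_C f Phi0 by move=> lA2 /(type_C_no_long_a2 rs).
have isC : ~ a2_pair f long -> type_C f Phi0.
  by move=> nA2; have [] := long_a2_or_type_C rs hred hirr hm m2 nA2.
have SD : short_full_data p S.
  have [lA2|nA2] := pselect (a2_pair f long).
    have [[sS [SL _] _] mS] := SnC (nC lA2).
    exact: short_full_of_subgroup.
  by apply: short_full_of_cosets => //; case: (SC (isC nA2)).
have sPsi := short_full_subsystem m2 pZ pL SD.
have [b lb] := long_inhabited; have [a0 sa0] := short_inhabited.
have proper : ~ Phi `<=` short_full p S.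
  move=> full.
  have LS : Ll `<=` translate (p b) S.
    move=> y Ly; have : Phi (b, y).
      by apply/roots_overP; split; [exact: lb.1|rewrite Lam_lE].
    move=> /full/short_fullP[[sb _]|[_ Sy]]; last exact/translateP.
    by case: (short_not_long rs hm m2 sb).
  have [lA2|nA2] := pselect (a2_pair f long); last first.
    by have [[_ _ /(_ _ lb)[_]]] := SC (isC nA2).
  have [[sS [SL nS] _] _] := SnC (nC lA2); apply: nS => y Ly.
  have := LS (p b + y) (subgroupD (Ll_subgroup lA2) (pLl _ lb) Ly).
  by move/translateP; rewrite addrC addKr.
apply: (section_maximal sPsi pZ pPsi proper) => Psi' H' S' sPsi' sub n' pPsi' D'.
have LH : Ls `<=` H'.
  apply: (data_full_short sPsi' pPsi' D'); exists a0 => // y Ly.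
  by apply: sub; apply/short_fullP; left.
have SS : S `<=` S'.
  move=> y Sy; have : short_full p S (b, p b + y).
    by apply/short_fullP; right; rewrite addrC addKr.
  by move/sub/(data_long D' _ lb); rewrite addrC addKr.
have adm' a : long a -> translate (p a) S' `<` Ll.
  by move=> la; exact: (data_proper sPsi' pPsi' D').
have SE : S' = S.
  have [lA2|nA2] := pselect (a2_pair f long); last first.
    have [_] := SC (isC nA2); apply=> //; apply: cosets_of_data => //.
    - by move=> y /(data_long_short D')/(data_sub D').
    - exact: (data_0 D').
    - by move=> x y Lx; apply: (data_add D'); exact: LH.
  have [[_ _ max] _] := SnC (nC lA2); apply: max => //.
    exact: (data_long_subgroup D' lA2).
  split; first exact: (data_sub_Ll sPsi' pPsi' D').
  move=> LS; have [_] := adm' _ lb; apply=> y Ly; apply/translateP; apply: LS.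
  by apply: (subgroupB (Ll_subgroup lA2)) => //; exact: pLl.
move=> [a y] ay; apply/short_fullP; have [Pa Ly] := subsystem_root sPsi' ay.
have [sa|la] := short_or_long rs hred hirr hm Pa.
  by left; split=> //; rewrite -(Lam_sE sa).
by right; split=> //; rewrite -SE; apply/(data_long D' _ la).
Qed.

(** A larger subsystem has a full long part and a subgroup H' that contains H;
    if H' were all of Lambda_s, it would be the full system. *)
Lemma long_full_maximal p H :
  Zlinear Phi0 p -> (forall a, Phi0 a -> long_full p H (a, p a)) ->
  (forall a, Phi0 a -> Lam a (p a)) ->
  generated Ll <> Ls -> maximal_subgroup Ls H -> Ll `<=` H ->
  maximal_root_subsystem (affine_form f) Phi (long_full p H).
Proof.
move=> pZ pPsi pL ngen [sH [HLs nH] max] LH.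
have sPsi := long_full_subsystem pZ pL sH LH HLs.
have [b lb] := long_inhabited; have [a0 sa0] := short_inhabited.
have pLs a : short a -> Ls (p a).
  by move=> sa; rewrite -(Lam_sE sa); apply: pL; exact: sa.1.
have m2 : (1 < m)%N.
  have mb := lacing_bounds rs hred hirr hm.
  have [m1|//] : m = 1%N \/ (1 < m)%N by lia.
  by case: nH; rewrite -(simply_laced_Lam m1).
have proper : ~ Phi `<=` long_full p H.
  move=> full; apply: nH => y Ly.
  have : Phi (a0, p a0 + y).
    apply/roots_overP; split; first exact: sa0.1.
    by rewrite (Lam_sE sa0); apply: (subgroupD Ls_subgroup) => //; exact: pLs.
  move=> /full/long_fullP[[_]|[la _]]; first by rewrite addrC addKr.
  by case: (short_not_long rs hm m2 sa0).
apply: (section_maximal sPsi pZ pPsi proper) => Psi' H' S' sPsi' sub n' pPsi' D'.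
have HH : H `<=` H'.
  move=> y Hy; have : long_full p H (a0, p a0 + y).
    by apply/long_fullP; left; rewrite addrC addKr.
  by move/sub/(data_short D' _ sa0); rewrite addrC addKr.
have HE : H' = H.
  apply: max => //; first exact: (data_subgroup D').
  split; first exact: (data_sub D').
  move=> LH'; apply: n'; apply: (data_full_all sPsi' pPsi' D' LH' lb) => y Ly.
  by apply/(data_long D' _ lb); apply: sub; apply/long_fullP; right.
move=> [a y] ay; apply/long_fullP; have [Pa Ly] := subsystem_root sPsi' ay.
have [sa|la] := short_or_long rs hred hirr hm Pa.
  by left; split=> //; rewrite -HE; apply/(data_short D' _ sa).
by right; split=> //; rewrite -(Lam_lE la).
Qed.

(** Suppose that a larger subsystem has all of Lambda_s over the short roots.
    Then its long fibres are closed under m Lambda_s. Every element of p_a +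
    Lambda_s differs from an element of p_a + H by an element of m Lambda_s, so
    the long fibres are full. *)
Lemma coset_roots_maximal p H :
  Zlinear Phi0 p -> (forall a, Phi0 a -> coset_roots p H (a, p a)) ->
  (forall a, Phi0 a -> Lam a (p a)) ->
  maximal_subgroup Ls H -> sumset mLs H = Ls ->
  maximal_root_subsystem (affine_form f) Phi (coset_roots p H).
Proof.
move=> pZ pPsi pL [sH [HLs nH] max] mH.
have sPsi := coset_roots_subsystem pZ pL sH HLs.
have cP := coset_rootsP _ _ sH HLs pL.
have [b lb] := long_inhabited; have [a0 sa0] := short_inhabited.
have pLs a : short a -> Ls (p a).
  by move=> sa; rewrite -(Lam_sE sa); apply: pL; exact: sa.1.
have proper : ~ Phi `<=` coset_roots p H.
  move=> full; apply: nH => y Ly.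
  have : Phi (a0, p a0 + y).
    apply/roots_overP; split; first exact: sa0.1.
    by rewrite (Lam_sE sa0); apply: (subgroupD Ls_subgroup) => //; exact: pLs.
  by move=> /full/cP[_]; rewrite addrC addKr.
apply: (section_maximal sPsi pZ pPsi proper) => Psi' H' S' sPsi' sub n' pPsi' D'.
have HH : H `<=` H'.
  move=> y Hy; have : coset_roots p H (a0, p a0 + y).
    apply/cP; rewrite [_ - p a0]addrC addKr; split=> //.
    apply/roots_overP; split; first exact: sa0.1.
    rewrite (Lam_sE sa0); apply: (subgroupD Ls_subgroup); [exact: pLs|exact: HLs].
  by move/sub/(data_short D' _ sa0); rewrite addrC addKr.
have HE : H' = H.
  apply: max => //; first exact: (data_subgroup D').
  split; first exact: (data_sub D').
  move=> LH'; apply: n'; apply: (data_full_all sPsi' pPsi' D' LH' lb) => y Ly.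
  have pb : Ll (p b) by rewrite -(Lam_lE lb); apply: pL; exact: lb.1.
  have : sumset mLs H (y - p b).
    by rewrite mH; apply: (subgroupB Ls_subgroup); exact: Ll_sub_Ls.
  move=> [_ [x Lx <-] [h Hh hE]].
  rewrite -hE addrC; apply: (data_add D'); first exact: LH'.
  rewrite -[h](addKr (p b)) addrC; apply/(data_long D' _ lb); apply: sub; apply/cP.
  rewrite [_ - p b]addrC addKr; split=> //; apply/roots_overP; split; first exact: lb.1.
  have -> : p b + h = y + m%:R *: (- x).
    by rewrite scalerN -[y](subrK (p b)) -hE addrAC [_ *: _ + h]addrC addrK addrC.
  by rewrite (Lam_lE lb); apply: Ll_add => //; exact: (subgroupN Ls_subgroup).
move=> [a y] ay; have [Pa Ly] := subsystem_root sPsi' ay.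
apply/cP; split; first exact/roots_overP.
rewrite -HE; have [sa|la] := short_or_long rs hred hirr hm Pa.
  by apply/(data_short D' _ sa).
by apply: (data_long_short D'); apply/(data_long D' _ la).
Qed.

Lemma Zlinear0 : Zlinear Phi0 (fun=> 0 : Y).
Proof. by exists (fun=> 0) => // x y _ _; rewrite addr0. Qed.

Lemma short_subsystem : root_subsystem f Phi0 short.
Proof.
split; first exact: short_inhabited.
  by move=> a [].
by move=> a b sa sb; exact: (short_refl rs sa.1 sb).
Qed.

Lemma long_subsystem : root_subsystem f Phi0 long.
Proof.
split; first exact: long_inhabited.
  by move=> a [].
by move=> a b la lb; exact: (long_refl rs la.1 lb).
Qed.

Lemma simply_laced_or_both_lengths : m = 1%N \/
  (exists2 a, Phi0 a & ~ short a) /\ (exists2 a, Phi0 a & ~ long a).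
Proof.
have mb := lacing_bounds rs hred hirr hm.
have [m1|m2] : m = 1%N \/ (1 < m)%N by lia.
  by left.
have [a sa] := short_inhabited; have [b lb] := long_inhabited.
right; split.
  by exists b; [exact: lb.1|move=> sb; exact: (short_not_long rs hm m2 sb lb)].
by exists a; [exact: sa.1|exact: (short_not_long rs hm m2 sa)].
Qed.

(** If m = 1, all roots are long. If m > 1 and G had no long root, then G would
    lie in the proper subsystem of all short roots and be equal to it. *)
Lemma maximal_meets_long (G : set V) : maximal_root_subsystem f Phi0 G ->
  G <> short -> exists2 b, G b & long b.
Proof.
move=> [[[a Ga] GP Grefl] [_ nG] max] nGs; apply: contrapT => nlong.
have [m1|[[b Pb nb] _]] := simply_laced_or_both_lengths.
  by apply: nlong; exists a => //; case: (simply_laced hm m1 (GP _ Ga)).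
have Gs : G `<=` short.
  move=> c Gc; have [//|lc] := short_or_long rs hred hirr hm (GP _ Gc).
  by case: nlong; exists c.
apply: (max short short_subsystem).
  by split=> [c []//|/(_ _ Pb)].
by split=> // sG; apply: nGs; apply/seteqP.
Qed.

Lemma maximal_meets_short (G : set V) : maximal_root_subsystem f Phi0 G ->
  G <> long -> exists2 a, G a & short a.
Proof.
move=> [[[a Ga] GP Grefl] [_ nG] max] nGl; apply: contrapT => nshort.
have [m1|[_ [b Pb nb]]] := simply_laced_or_both_lengths.
  by apply: nshort; exists a => //; case: (simply_laced hm m1 (GP _ Ga)).
have Gl : G `<=` long.
  move=> c Gc; have [sc|//] := short_or_long rs hred hirr hm (GP _ Gc).
  by case: nshort; exists c.
apply: (max long long_subsystem).
  by split=> [c []//|/(_ _ Pb)].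
by split=> // lG; apply: nGl; apply/seteqP.
Qed.

(** Consider a larger proper subsystem whose gradient is everything. It has
    full fibres over G. If G has roots of both lengths it is the full system. If
    G consists of the short roots, then p_b lies in Lambda_l = m Lambda_s for b
    long, and m Lambda_s is contained in S. If G consists of the long roots,
    then -p_b lies in S because 0 lies in Lambda_l; hence H contains Lambda_l
    and the subgroup Lambda_s that it generates. *)
Lemma lift_maximal (G : set V) : maximal_root_subsystem f Phi0 G ->
  [\/ G <> short /\ G <> long, G = short /\ Ll = mLs |
      G = long /\ generated Ll = Ls] ->
  maximal_root_subsystem (affine_form f) Phi (lift G).
Proof.
move=> maxG cases; have [sG [GP nG] max] := maxG.
have sPsi := lift_subsystem sG.
have liftP a y : G a -> Lam a y -> lift G (a, y).
  by move=> Ga Ly; split=> //; apply/roots_overP; split=> //; exact: GP.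
apply/maximalP; split=> //.
  move=> full; apply: nG => a Pa.
  have : Phi (a, 0) by apply/roots_overP; split=> //; exact: extension_family.1.
  by move=> /full[].
move=> Psi' sPsi' sub n'.
have sG' := Gr_subsystem sPsi'.
have GG' : G `<=` Gr Phi0 Lam Psi'.
  move=> a Ga; apply/(GrP _ sPsi'); exists 0; apply/sub/liftP => //.
  by apply: extension_family.1; exact: GP.
have [onto|nonto] := pselect (Phi0 `<=` Gr Phi0 Lam Psi'); last first.
  have G'G : Gr Phi0 Lam Psi' `<=` G.
    apply: contrapT => nG'; apply: (max _ sG'); split=> //; by case: sG'.
  move=> [a y] ay; have [Pa Ly] := subsystem_root sPsi' ay.
  by apply: liftP => //; apply: G'G; apply/(GrP _ sPsi'); exists y.
have {}onto a : Phi0 a -> exists y, Psi' (a, y) by move/onto/(GrP _ sPsi').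
exfalso; apply: n'.
have fullG a y : G a -> Lam a y -> Psi' (a, y) by move=> Ga Ly; apply/sub/liftP.
have [p [pZ pPsi']] := subsystem_section sPsi' onto.
have [H [S D]] := subsystem_data sPsi' pZ pPsi'.
have [a0 sa0] := short_inhabited; have [b0 lb0] := long_inhabited.
case: cases => [[nGs nGl]|[Gs Lm]|[Gl gL]].
- have [b Gb lb] := maximal_meets_long maxG nGs.
  have [a Ga sa] := maximal_meets_short maxG nGl.
  apply: (full_all sPsi' onto sa lb) => y Ly; apply: fullG => //.
    by rewrite Lam_sE.
  by rewrite Lam_lE.
- have LH : Ls `<=` H.
    apply: (data_full_short sPsi' pPsi' D); exists a0 => // y Ly.
    by apply: fullG; rewrite ?Gs ?Lam_sE.
  apply: (data_full_all sPsi' pPsi' D LH lb0) => y Ly.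
  have : mLs (y - p b0).
    by apply: (subgroupB mLs_subgroup); rewrite -Lm //; exact: (section_Ll sPsi' pPsi').
  move=> [x Lx <-]; rewrite -[_ *: _]add0r; apply: (data_add D); first exact: LH.
  exact: (data_0 D).
- have Sb y : Ll y -> S (y - p b0).
    move=> Ly; apply/(data_long D _ lb0); apply: fullG; rewrite ?Gl //.
    by rewrite Lam_lE.
  apply: (data_full_all sPsi' pPsi' D _ lb0 Sb).
  have sH := data_subgroup D.
  rewrite -gL; apply: generated_min => // y Ly.
  have : H (y - p b0 - (0 - p b0)).
    by apply: (subgroupB sH); apply: (data_long_short D); apply: Sb => //; exact: Ll0.
  by rewrite sub0r opprK subrK.
Qed.

(** * Necessary conditions for maximality *)

Lemma Lam_0 a : Phi0 a -> Lam a 0.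
Proof. exact: extension_family.1. Qed.

Lemma short_full_mLs : short_full_data (fun=> 0) mLs.
Proof.
split.
- exact: mLs_subgroup.1.
- exact: mLs_sub_Ls.
- move=> x _ Lx [y Ly <-]; exists (y + x); last by rewrite scalerDr.
  exact: (subgroupD Ls_subgroup).
- by move=> _; exact: mLs_subgroup.
- by move=> a la y /translateP; rewrite subr0; exact: mLs_sub_Ll.
Qed.

Lemma generated_Ll_sub : generated Ll `<=` Ls.
Proof. by apply: generated_min; [exact: Ls_subgroup|exact: Ll_sub_Ls]. Qed.

(** For a gradient of all short roots the subsystem is compared with the one
    that has in addition m Lambda_s over the long roots; for all long roots, with
    the one that has in addition the subgroup generated by Lambda_l over the
    short roots. Both comparisons use the section p = 0. *)
Lemma maximal_not_onto Psi : maximal_root_subsystem (affine_form f) Phi Psi ->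
  Gr Phi0 Lam Psi <> Phi0 ->
  let G := Gr Phi0 Lam Psi in
  [/\ maximal_root_subsystem f Phi0 G,
      forall a, G a -> Y_ Lam Psi a = Lam a &
      [\/ G <> short /\ G <> long, G = short /\ Ll = mLs |
          G = long /\ generated Ll = Ls]].
Proof.
move=> /maximalP[sPsi n max] nGr G.
have sG : root_subsystem f Phi0 G by exact: Gr_subsystem.
have GP : G `<=` Phi0 by move=> a [].
have subG a y : Psi (a, y) -> G a by move=> ay; apply/(GrP _ sPsi); exists y.
have nG : ~ Phi0 `<=` G by move=> PG; apply: nGr; apply/seteqP.
have max_lift G' : root_subsystem f Phi0 G' -> G `<=` G' -> ~ Phi0 `<=` G' ->
    lift G' `<=` Psi.
  move=> sG' GG' nG'; apply: max; first exact: lift_subsystem.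
    move=> [a y] ay; split; last by apply: GG'; exact: (subG _ _ ay).
    by case: sPsi => _ sub _; exact: sub.
  move=> full; apply: nG' => a Pa.
  have : Phi (a, 0) by apply/roots_overP; split=> //; exact: Lam_0.
  by move=> /full[].
have maxG : maximal_root_subsystem f Phi0 G.
  split=> // G' sG' [G'P nG'] [GG' nG'G]; apply: nG'G => a Ga.
  have : lift G' (a, 0).
    by split=> //; apply/roots_overP; split; [exact: G'P|apply/Lam_0/G'P].
  by move=> /(max_lift _ sG' GG' nG')/subG.
split=> //.
  move=> a Ga; apply/seteqP; split=> [y []//|y Ly]; split=> //.
  apply: (max_lift G) => //; split=> //.
  by apply/roots_overP; split=> //; exact: GP.
have [a0 sa0] := short_inhabited; have [b0 lb0] := long_inhabited.
have mb := lacing_bounds rs hred hirr hm.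
have zeroL a : Phi0 a -> Lam a 0 by exact: Lam_0.
have [Gs|nGs] := pselect (G = short).
  have m2 : (1 < m)%N.
    have [m1|//] : m = 1%N \/ (1 < m)%N by lia.
    by case: nG => a Pa; rewrite Gs; case: (simply_laced hm m1 Pa).
  have SD : short_full_data (fun=> 0) mLs by exact: short_full_mLs.
  have sT := short_full_subsystem m2 Zlinear0 zeroL SD.
  apply: Or32; split=> //; apply/seteqP; split; last exact: mLs_sub_Ll.
  have : Phi `<=` short_full (fun=> 0) mLs.
    apply: contrapT => nT; have := max _ sT _ nT.
    have sub : Psi `<=` short_full (fun=> 0) mLs.
      move=> [a y] ay; apply/short_fullP; left.
      have sa : short a by rewrite -Gs; exact: (subG _ _ ay).
      split=> //; rewrite -(Lam_sE sa); by case: (subsystem_root sPsi ay).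
    move=> /(_ sub) TPsi; have : short_full (fun=> 0) mLs (b0, 0).
      by apply/short_fullP; right; split=> //; rewrite subr0; exact: mLs_subgroup.1.
    move/TPsi/subG; rewrite Gs => sb0; exact: (short_not_long rs hm m2 sb0).
  move=> full y Ly; have : Phi (b0, y).
    by apply/roots_overP; split; [exact: lb0.1|rewrite Lam_lE].
  move/full/short_fullP => [[sb0 _]|[_]]; last by rewrite subr0.
  by case: (short_not_long rs hm m2 sb0).
have [Gl|nGl] := pselect (G = long); last by apply: Or31.
apply: Or33; split=> //; apply/seteqP; split; first exact: generated_Ll_sub.
have m2 : (1 < m)%N.
  have [m1|//] : m = 1%N \/ (1 < m)%N by lia.
  by case: nG => a Pa; rewrite Gl; case: (simply_laced hm m1 Pa).
have sT := long_full_subsystem Zlinear0 zeroL (generated_subgroup Ll)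
  (@sub_generated _ Ll) generated_Ll_sub.
have : Phi `<=` long_full (fun=> 0) (generated Ll).
  apply: contrapT => nT; have := max _ sT _ nT.
  have sub : Psi `<=` long_full (fun=> 0) (generated Ll).
    move=> [a y] ay; apply/long_fullP; right.
    have la : long a by rewrite -Gl; exact: (subG _ _ ay).
    split=> //; rewrite -(Lam_lE la); by case: (subsystem_root sPsi ay).
  move=> /(_ sub) TPsi; have : long_full (fun=> 0) (generated Ll) (a0, 0).
    apply/long_fullP; left; split=> //; rewrite subr0.
    exact: (generated_subgroup Ll).1.
  by move/TPsi/subG; rewrite Gl; exact: (short_not_long rs hm m2 sa0).
move=> full y Ly; have : Phi (a0, y).
  by apply/roots_overP; split; [exact: sa0.1|rewrite Lam_sE].
move/full/long_fullP => [[_]|[la0 _]]; first by rewrite subr0.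
by case: (short_not_long rs hm m2 sa0).
Qed.

Lemma maximal_onto_full_short Psi p H S :
  maximal_root_subsystem (affine_form f) Phi Psi -> Zlinear Phi0 p ->
  (forall a, Phi0 a -> Psi (a, p a)) -> coset_data Psi p H S -> Ls `<=` H ->
  [/\ Ll <> mLs, Psi = short_full p S,
      forall a, long a -> translate (p a) S `<=` Ll,
      ~ type_C f Phi0 -> maximal_subgroup Ll S /\ mLs `<=` S &
      type_C f Phi0 -> maximal_coset_union long p mLs Ls Ll S].
Proof.
move=> /maximalP[sPsi n max] pZ pPsi D LH.
have [a0 sa0] := short_inhabited; have [b0 lb0] := long_inhabited.
have pL := section_Lam sPsi pPsi.
have pLl := section_Ll sPsi pPsi.
have mS : mLs `<=` S.
  move=> _ [x Lx <-]; rewrite -[_ *: _]add0r; apply: (data_add D); first exact: LH.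
  exact: (data_0 D).
have proper a : long a -> translate (p a) S `<` Ll := data_proper sPsi pPsi D LH n.
have nLl : Ll <> mLs.
  move=> Lm; apply: n; apply: (data_full_all sPsi pPsi D LH lb0) => y Ly.
  by apply: mS; apply: (subgroupB mLs_subgroup); rewrite -Lm //; exact: pLl.
have m2 := multiply_laced nLl.
have PsiE : Psi = short_full p S.
  apply/seteqP; split=> [[a y] ay|[a y] /short_fullP[[sa Ly]|[la Sy]]].
  - have [Pa Ly] := subsystem_root sPsi ay; apply/short_fullP.
    have [sa|la] := short_or_long rs hred hirr hm Pa.
      by left; split=> //; rewrite -(Lam_sE sa).
    by right; split=> //; apply/(data_long D _ la).
  - exact: (data_short_full sPsi pPsi D).
  - by apply/(data_long D _ la).
have enlarge S' : short_full_data p S' -> S `<=` S' -> translate (p b0) S' `<` Ll ->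
    S' = S.
  move=> SD' SS' [_ nS']; apply/seteqP; split=> // y Sy.
  have : short_full p S' `<=` Psi.
    apply: max; first exact: short_full_subsystem.
      rewrite PsiE => -[a z] /short_fullP[az|[la Sz]]; apply/short_fullP; first by left.
      by right; split=> //; exact: SS'.
    move=> full; apply: nS' => z Lz; apply/translateP.
    have : Phi (b0, z) by apply/roots_overP; split; [exact: lb0.1|rewrite Lam_lE].
    move=> /full/short_fullP[[sb0 _]|[]//].
    by case: (short_not_long rs hm m2 sb0).
  have yb : short_full p S' (b0, p b0 + y).
    by apply/short_fullP; right; rewrite addrC addKr.
  by move=> /(_ _ yb)/(data_long D _ lb0); rewrite addrC addKr.
split=> //.
- by move=> a /proper[].
- move=> nC; have lA2 : a2_pair f long.
    apply: contrapT => nA2; apply: nC.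
    by have [] := long_a2_or_type_C rs hred hirr hm m2 nA2.
  have SLl := data_sub_Ll sPsi pPsi D lA2.
  split=> //; split=> [||K sK SK [KL nK]].
  + exact: (data_long_subgroup D lA2).
  + split=> // LS; have [_] := proper _ lb0; apply=> y Ly; apply/translateP.
    by apply: LS; apply: (subgroupB (Ll_subgroup lA2)) => //; exact: pLl.
  + have SD : short_full_data p K.
      by apply: short_full_of_subgroup => // y /mS; exact: SK.
    apply: enlarge => //; split; first exact: (sf_Ll SD).
    move=> LK; apply: nK => y Ly.
    have := LK _ (subgroupD (Ll_subgroup lA2) (pLl _ lb0) Ly).
    by move/translateP; rewrite addrC addKr.
- move=> C; have nA2 := type_C_no_long_a2 rs C; split.
    apply: cosets_of_data => //; [|exact: (data_0 D)|].
      by move=> y /(data_long_short D)/(data_sub D).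
    by move=> x y Lx; apply: (data_add D); exact: LH.
  move=> S' adm SS'; apply: enlarge => //; first exact: short_full_of_cosets.
  by case: adm => _ _; apply.
Qed.

Lemma coset_enlarge Psi p H S K : maximal_root_subsystem (affine_form f) Phi Psi ->
  Zlinear Phi0 p -> (forall a, Phi0 a -> Psi (a, p a)) -> coset_data Psi p H S ->
  subgroup K -> H `<=` K -> K `<=` Ls -> ~ Ls `<=` K -> Psi = coset_roots p K /\ K = H.
Proof.
move=> /maximalP[sPsi n max] pZ pPsi D sK HK KL nK.
have pL := section_Lam sPsi pPsi; have pLs := section_Ls sPsi pPsi.
have [a0 sa0] := short_inhabited.
have cP := coset_rootsP _ _ sK KL pL.
have sub : Psi `<=` coset_roots p K.
  move=> [a y] ay; have [Pa Ly] := subsystem_root sPsi ay.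
  apply/cP; split; first exact/roots_overP; apply: HK.
  have [sa|la] := short_or_long rs hred hirr hm Pa.
    by apply/(data_short D _ sa).
  by apply: (data_long_short D); apply/(data_long D _ la).
have PhiL y : Ls y -> Phi (a0, p a0 + y).
  move=> Ly; apply/roots_overP; split; first exact: sa0.1.
  by rewrite (Lam_sE sa0); apply: (subgroupD Ls_subgroup) => //; exact: pLs.
have sub' : coset_roots p K `<=` Psi.
  apply: max => //; first exact: coset_roots_subsystem.
  move=> full; apply: nK => y Ly.
  by have /full/cP[_] := PhiL _ Ly; rewrite addrC addKr.
split; apply/seteqP; split=> // y Ky.
have : coset_roots p K (a0, p a0 + y).
  by apply/cP; split; [apply: PhiL; exact: KL|rewrite addrC addKr].
by move=> /sub'/(data_short D _ sa0); rewrite addrC addKr.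
Qed.

Lemma sumset_subgroup (A B : set Y) : subgroup A -> subgroup B -> subgroup (sumset A B).
Proof.
move=> sA sB; split=> [|_ _ [x Ax [y Bw <-]] [u Au [v Bv <-]]].
  by exists 0; [exact: sA.1|exists 0; [exact: sB.1|rewrite addr0]].
exists (x - u); first exact: (subgroupB sA).
by exists (y - v); [exact: (subgroupB sB)|rewrite opprD addrACA].
Qed.

(** If m Lambda_s + H is not Lambda_s, it equals H by maximality. Then S is also
    closed under m Lambda_s, and the short part may be replaced by all of
    Lambda_s. The resulting subsystem is strictly larger than Psi, hence full. *)
Lemma maximal_onto_cosets Psi p H S :
  maximal_root_subsystem (affine_form f) Phi Psi -> Zlinear Phi0 p ->
  (forall a, Phi0 a -> Psi (a, p a)) -> coset_data Psi p H S -> ~ Ls `<=` H ->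
  maximal_subgroup Ls H /\
  ((generated Ll <> Ls /\ Psi = long_full p H /\ Ll `<=` H) \/
   (Psi = coset_roots p H /\ sumset mLs H = Ls)).
Proof.
move=> maxPsi pZ pPsi D nLH; have [sPsi n max] := (maximalP _).1 maxPsi.
have sH := data_subgroup D; have HLs := data_sub D.
have [a0 sa0] := short_inhabited; have [b0 lb0] := long_inhabited.
have pL := section_Lam sPsi pPsi.
have enlarge K := @coset_enlarge _ _ _ _ K maxPsi pZ pPsi D.
have PsiE : Psi = coset_roots p H by case: (enlarge H).
have cP := coset_rootsP _ _ sH HLs pL.
have maxH : maximal_subgroup Ls H.
  by split=> // K sK HK [KL nK]; case: (enlarge K).
split=> //; pose K := sumset mLs H.
have sK : subgroup K by apply: sumset_subgroup => //; exact: mLs_subgroup.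
have HK : H `<=` K.
  by move=> y Hy; exists 0; [exact: mLs_subgroup.1|exists y; rewrite ?add0r].
have mK : mLs `<=` K.
  by move=> y my; exists y => //; exists 0; [exact: sH.1|rewrite addr0].
have KL : K `<=` Ls.
  move=> _ [x mx [y Hy <-]].
  by apply: (subgroupD Ls_subgroup); [exact: mLs_sub_Ls|exact: HLs].
have [LK|nLK] := pselect (Ls `<=` K); first by right; split=> //; apply/seteqP.
left; have [_ KH] := enlarge K sK HK KL nLK.
have mH : mLs `<=` H by rewrite -KH.
have m2 : (1 < m)%N.
  have mb := lacing_bounds rs hred hirr hm.
  have [m1|//] : m = 1%N \/ (1 < m)%N by lia.
  by case: nLH; rewrite -(simply_laced_Lam m1) (simply_laced_mLs m1).
have SP b y : long b -> S (y - p b) <-> Ll y /\ H (y - p b).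
  move=> lb; split=> [Sy|[Ly Hy]].
    split; last exact: (data_long_short D).
    by have /(data_long D _ lb)/(subsystem_root sPsi)[_] := Sy; rewrite Lam_lE.
  apply/(data_long D _ lb); rewrite PsiE; apply/cP; split=> //.
  by apply/roots_overP; split; [exact: lb.1|rewrite Lam_lE].
have SD : short_full_data p S.
  split; first exact: (data_0 D).
  - by move=> y /(data_long_short D); exact: HLs.
  - move=> x y Lx Sy.
    have /(SP _ _ lb0)[Ly Hy] : S (p b0 + y - p b0) by rewrite addrC addKr.
    have : S (p b0 + (y + m%:R *: x) - p b0).
      apply/(SP _ _ lb0); split; first by rewrite addrA; exact: Ll_add.
      rewrite addrC addKr; apply: (subgroupD sH); first exact: (data_long_short D).
      by apply: mH; exists x.
    by rewrite addrC addKr.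
  - exact: (data_long_subgroup D).
  - by move=> b lb y /translateP/(SP _ _ lb)[].
have full : Phi `<=` short_full p S.
  apply: contrapT => nfull.
  have sub : Psi `<=` short_full p S.
    move=> [a y] ay; have [Pa Ly] := subsystem_root sPsi ay; apply/short_fullP.
    have [sa|la] := short_or_long rs hred hirr hm Pa.
      by left; split=> //; rewrite -(Lam_sE sa).
    by right; split=> //; apply/(data_long D _ la).
  have sub' := max _ (short_full_subsystem m2 pZ pL SD) sub nfull.
  apply: nLH; apply: (data_full_short sPsi pPsi D); exists a0 => // y Ly.
  by apply: sub'; apply/short_fullP; left.
have Sall b y : long b -> Ll y -> S (y - p b).
  move=> lb Ly; have : Phi (b, y).
    by apply/roots_overP; split; [exact: lb.1|rewrite Lam_lE].
  move=> /full/short_fullP[[sb _]|[]//].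
  by case: (short_not_long rs hm m2 sb).
have LlH : Ll `<=` H.
  move=> y Ly.
  have : H (y - p b0 - (0 - p b0)).
    by apply: (subgroupB sH); apply: (data_long_short D); apply: Sall => //; exact: Ll0.
  by rewrite sub0r opprK subrK.
split; first by move=> gL; apply: nLH; rewrite -gL; exact: generated_min.
split=> //; apply/seteqP; split=> [[a y] ay|[a y] /long_fullP[[sa Hy]|[la Ly]]].
- have [Pa Ly] := subsystem_root sPsi ay; apply/long_fullP.
  have [sa|la] := short_or_long rs hred hirr hm Pa.
    by left; split=> //; apply/(data_short D _ sa).
  by right; split=> //; rewrite -(Lam_lE la).
- by apply/(data_short D _ sa).
- by apply/(data_long D _ la); exact: Sall.
Qed.
End Affine.

Theorem theorem3 (R : realType) (V Y : vectType R) (f : {dot V for idfun})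
    (Phi0 : set V) (Lam : V -> set Y) (m : nat) (Psi : set (V * Y))
    (hPhi0 : root_system f Phi0) (hred : reduced Phi0)
    (hirr : irreducible f Phi0) (hLam : extension_datum f Phi0 Lam)
    (hm : lacing_number f Phi0 m)
    (hB : ~ type_B f Phi0) (hA1 : ~ type_A1 Phi0)
    (hPsi : Psi `<=` affine_roots Phi0 Lam) :
  let Phis := short_roots f Phi0 in
  let Phil := long_roots f Phi0 in
  let Ls := Lam_s f Phi0 Lam in
  let Ll := Lam_l f Phi0 Lam in
  let mLs := dilate m%:R Ls in
  let GrPsi := Gr Phi0 Lam Psi in
  maximal_root_subsystem (affine_form f) (affine_roots Phi0 Lam) Psi <->
  (exists p : V -> Y,
     [/\ Zlinear Phi0 p,
         forall a, Phi0 a -> Y_ Lam Psi a (p a) &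
         [\/ (* (1.i) *)
             Ll <> mLs /\
             exists S : set Y,
               [/\ Psi = roots_over Phis (fun=> Ls) `|`
                         roots_over Phil (fun a => translate (p a) S),
                   forall a, Phil a -> translate (p a) S `<=` Ll,
                   ~ type_C f Phi0 -> maximal_subgroup Ll S /\ mLs `<=` S &
                   type_C f Phi0 -> maximal_coset_union Phil p mLs Ls Ll S],
             (* (1.ii) *)
             generated Ll <> Ls /\
             exists H : set Y,
               [/\ Psi = roots_over Phis (fun a => translate (p a) H) `|`
                         roots_over Phil (fun=> Ll),
                   maximal_subgroup Ls H & Ll `<=` H]
           | (* (1.iii) *)
             exists H : set Y,
               [/\ Psi = roots_over Phis (fun a => translate (p a) H) `|`
                         roots_over Phil (fun a => translate (p a) H `&` Ll),
                   maximal_subgroup Ls H & sumset mLs H = Ls]]])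
  \/
  [/\ maximal_root_subsystem f Phi0 GrPsi,
      forall a, GrPsi a -> Y_ Lam Psi a = Lam a &
      [\/ (* (2.a) *) GrPsi <> Phis /\ GrPsi <> Phil,
          (* (2.b) *) GrPsi = Phis /\ Ll = mLs
        | (* (2.c) *) GrPsi = Phil /\ generated Ll = Ls]].
Proof.
move=> Phis Phil Ls Ll mLs GrPsi.
have hA2 : a2_pair f Phis by exact: short_a2_or_type_B hm hA1 hB.
split=> [maxPsi|[[p [pZ pY cases]]|[maxG fullG cases]]].
- have [onto|nonto] := pselect (GrPsi = Phi0); last first.
    by right; exact: (maximal_not_onto hPhi0 hred hirr hLam hm hA2 maxPsi nonto).
  left; have [sPsi _ _] := maxPsi.
  have ontoP a : Phi0 a -> exists y, Psi (a, y).
    by rewrite -onto => -[_ [y _ ay]]; exists y.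
  have [p [pZ pPsi]] := subsystem_section hPhi0 hred sPsi ontoP.
  have [H [S D]] := subsystem_data hPhi0 hred hirr hLam hm hA2 sPsi pZ pPsi.
  exists p; split=> //.
    by move=> a Pa; split; [exact: (section_Lam sPsi pPsi)|exact: pPsi].
  have [LH|nLH] := pselect (Ls `<=` H).
    have [nLl E sub nC C] :=
      maximal_onto_full_short hPhi0 hred hirr hLam hm hA2 maxPsi pZ pPsi D LH.
    by apply: Or31; split=> //; exists S; split.
  have [maxH [[ngen [E LlH]]|[E mH]]] :=
    maximal_onto_cosets hPhi0 hred hirr hLam hm hA2 maxPsi pZ pPsi D nLH.
    by apply: Or32; split=> //; exists H.
  by apply: Or33; exists H.
- have pL a : Phi0 a -> Lam a (p a) by move=> /pY[].
  have pPsi a : Phi0 a -> Psi (a, p a) by move=> /pY[].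
  case: cases => [[nLl [S [E sub nC C]]]|[ngen [H [E maxH LlH]]]|[H [E maxH mH]]].
  + rewrite E; apply: (short_full_maximal hPhi0 hred hirr hLam hm hA2) => //.
    by move: pPsi; rewrite E.
  + rewrite E; apply: (long_full_maximal hPhi0 hred hirr hLam hm hA2) => //.
    by move: pPsi; rewrite E.
  + rewrite E; apply: (coset_roots_maximal hPhi0 hred hirr hLam hm hA2) => //.
    by move: pPsi; rewrite E.
- have -> : Psi = lift (Phi0 := Phi0) (Lam := Lam) GrPsi.
    apply/seteqP; split=> [[a y] ay|[a y] [/roots_overP[Pa Ly] Ga]].
      have Pay := hPsi _ ay; have /roots_overP[Pa Ly] := Pay.
      by split=> //; split=> //; exists y.
    have : Y_ Lam Psi a y by rewrite fullG.
    by case.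
  exact: (lift_maximal hPhi0 hred hirr hLam hm hA2).
Qed.
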